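(* Let $n\geq 5$ and $\lambda\geq 4$ be integers and let $G\in \mathrm{Min}\,G(n,3,\lambda,1)$. Then the oriented diameter of $G$ is at most $9$.
   Context: All graphs are finite and simple. The diameter of a graph $G$ (resp. digraph $D$) is $\max\{d(u,v)\mid u,v\in V(G)\}$ (resp. $\max\{d(u,v)\mid u,v\in V(D)\}$, with $d(u,v)$ the length of a shortest directed path from $u$ to $v$); it is infinite if some vertex is not reachable from another. An orientation of a graph $G$ is a digraph obtained from $G$ by replacing each edge by exactly one of the two possible arcs with the same ends. A graph is bridgeless if it has no cut-edge. The oriented diameter of a bridgeless graph $G$ is $\min\{diam(\overrightarrow{G})\mid \overrightarrow{G}\text{ is an orientation of }G\}$. For integers $n,k,\lambda,s$ with $\lambda>k$, $G(n,k,\lambda,s)$ denotes the class of graphs with $n$ vertices and diameter at most $k$ which have the property that deleting any $s$ or fewer edges leaves a graph of diameter at most $\lambda$. $\mathrm{Min}\,G(n,k,\lambda,s)$ denotes the subclass of $G(n,k,\lambda,s)$ consisting of those graphs having the minimum number of edges among all graphs in $G(n,k,\lambda,s)$. *)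

(* Defs.v *)
From HB Require Import structures.
From mathcomp Require Import all_boot all_order all_algebra.
From mathcomp Require Import constructive_ereal.

Set Implicit Arguments.
Unset Strict Implicit.
Unset Printing Implicit Defensive.

Import Order.TTheory GRing.Theory Num.Theory.

(* Distances and diameters live in \bar int, with +oo for unreachability. *)

Section Distance.
Variables (T : finType) (e : rel T).

(* Vertices of a path are pairwise distinct, so it has fewer than #|T| arcs;
   the range d < #|T| below is therefore no restriction. *)
Definition path_of_length (u v : T) (d : nat) : bool :=
  [exists p : d.-tuple T, [&& path e u p, uniq (u :: p) & last u p == v]].

Definition dist (u v : T) : \bar int :=
  \big[Order.min/+oo%E]_(d < #|T| | path_of_length u v d) (d%:Z)%:E%E.

Definition diam : \bar int :=
  \big[Order.max/0%:E%E]_(u : T) \big[Order.max/0%:E%E]_(v : T) dist u v.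

End Distance.

Record sgraph := SGraph {
  vertex :> finType;
  adj : rel vertex;
  adj_sym : symmetric adj;
  adj_irr : irreflexive adj }.

Definition edges (G : sgraph) : {set {set G}} :=
  [set [set uv.1; uv.2] | uv : G * G & adj uv.1 uv.2].

Section DeleteEdges.
Variables (G : sgraph) (S : {set {set G}}).

Definition del_adj : rel G :=
  fun u v => adj u v && ([set u; v] \notin S).

Lemma del_adj_sym : symmetric del_adj.
Proof. by move=> u v; rewrite /del_adj adj_sym setUC. Qed.

Lemma del_adj_irr : irreflexive del_adj.
Proof. by move=> u; rewrite /del_adj adj_irr. Qed.

Definition del_edges : sgraph := SGraph del_adj_sym del_adj_irr.

End DeleteEdges.

Definition graph_diam (G : sgraph) : \bar int := diam (@adj G).

(* A digraph on T is its set of arcs. *)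
Definition arc (T : finType) (D : {set T * T}) : rel T :=
  fun u v => (u, v) \in D.

Definition is_orientation (G : sgraph) (D : {set G * G}) : bool :=
  [forall u : G, forall v : G,
     if adj u v then arc D u v (+) arc D v u else ~~ arc D u v].

(* Finite exactly when some orientation is strongly connected, which forces G
   to be bridgeless. *)
Definition oriented_diam (G : sgraph) : \bar int :=
  \big[Order.min/+oo%E]_(D : {set G * G} | is_orientation D) diam (arc D).

(* Used for lam > k only. *)
Definition in_class (n k lam s : nat) (G : sgraph) : Prop :=
  [/\ #|G| = n,
      (graph_diam G <= (k%:Z)%:E)%E
    & forall S : {set {set G}}, S \subset edges G -> #|S| <= s ->
        (graph_diam (del_edges S) <= (lam%:Z)%:E)%E].

Definition in_min_class (n k lam s : nat) (G : sgraph) : Prop :=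
  in_class n k lam s G /\
  forall H : sgraph, in_class n k lam s H -> #|edges G| <= #|edges H|.

(* Main.v *)
(** Counting degrees by distance layers around a vertex of degree 2 with adjacent
    neighbours shows that a bridgeless graph of diameter at most 3 in which all
    vertices of degree 2 lie in triangles satisfies 2e >= 3n - 3.  On the other
    hand, 5-cycles glued along a common path a - c - b (with a second middle vertex
    c when n is even) have 2e <= 3n - 4, and any two of their vertices are joined
    by edge-disjoint paths of lengths at most 3 and 4, so they belong to the class.
    Hence a minimal G has a vertex v of degree 2 with nonadjacent neighbours a, b.

    Orient b -> v -> a and let the rest of G flow from a to b.  All vertices other
    than v are within distance 2 of a or of b, and within distance 3 of both.  The
    flow can be arranged so that every vertex is within 2 steps of a, or within 3
    steps of b, or belongs to an exceptional set of vertices within 4 steps of b;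
    symmetrically for the distances from b and from a.  Passing through b -> v -> a
    this gives at most 3 + 2 + 4 steps, unless the start and the end are both
    exceptional; but then the flow follows a path of length at most 3 of G between
    them, up to one step at either end. *)

Require Import Defs.
From HB Require Import structures.
From mathcomp Require Import all_boot all_order all_algebra.
From mathcomp Require Import constructive_ereal.
From mathcomp Require Import zify.

Set Implicit Arguments.
Unset Strict Implicit.
Unset Printing Implicit Defensive.

Import Order.TTheory.

(** * Bounded reachability, distance and diameter *)

Fixpoint within (T : finType) (e : rel T) (k : nat) (u w : T) : bool :=
  (u == w) ||
  (if k is k'.+1 then [exists x, e u x && within e k' x w] else false).

Section Within.
Variables (T : finType) (e : rel T).

Lemma within_refl k u : within e k u u.
Proof. by case: k => [|k] /=; rewrite eqxx. Qed.

Lemma within_step k u x w : e u x -> within e k x w -> within e k.+1 u w.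
Proof. by move=> ux xw /=; apply/orP; right; apply/existsP; exists x; rewrite ux. Qed.

Lemma within1 k u w : e u w -> within e k.+1 u w.
Proof. by move=> uw; apply: within_step uw _; apply: within_refl. Qed.

Lemma within_mono j k u w : j <= k -> within e j u w -> within e k u w.
Proof.
elim: j k u => [|j IH] [|k] u //= jk; first by rewrite orbF => ->.
case/orP=> [->//|/existsP[x /andP[ux xw]]].
by apply/orP; right; apply/existsP; exists x; rewrite ux IH.
Qed.

Lemma within_trans j k u x w :
  within e j u x -> within e k x w -> within e (j + k) u w.
Proof.
elim: j u => [|j IH] u; first by rewrite /= orbF => /eqP->.
rewrite addSn => /orP[/eqP->|/existsP[y /andP[uy yx]]] xw; last first.
  by apply: within_step uy (IH _ yx xw).
by apply: within_mono xw; rewrite -addSn leq_addl.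
Qed.

Lemma within_path k u w :
  reflect (exists p, [/\ path e u p, last u p = w & size p <= k])
          (within e k u w).
Proof.
apply: (iffP idP) => [|[p [+ + +]]].
  elim: k u => [|k IH] u /=; first by rewrite orbF => /eqP->; exists [::].
  case/orP=> [/eqP->|/existsP[x /andP[ux /IH[p [xp lp sp]]]]].
    by exists [::].
  by exists (x :: p); rewrite /= ux.
elim: p k u => [|x p IH] k u /=; first by move=> _ -> _; apply: within_refl.
case/andP=> ux xp lp; case: k => // k sp; apply: within_step ux _; exact: IH.
Qed.

Lemma within3P x y : within e 3 x y ->
  [\/ x = y, e x y, exists2 u, e x u & e u y |
      exists u w, [/\ e x u, e u w & e w y]].
Proof.
case/orP=> [/eqP->|/existsP[u /andP[xu]]]; first by constructor 1.
case/orP=> [/eqP<-|/existsP[w /andP[uw]]]; first by constructor 2.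
case/orP=> [/eqP<-|/existsP[y' /andP[wy]]]; first by constructor 3; exists u.
by rewrite /= orbF => /eqP<-; constructor 4; exists u, w.
Qed.

End Within.

Lemma within_sub (T : finType) (e e' : rel T) k u w :
  subrel e e' -> within e k u w -> within e' k u w.
Proof.
move=> ee' /within_path[p [ep lp sp]]; apply/within_path; exists p.
by split=> //; apply: sub_path ep.
Qed.

Lemma within_rev (T : finType) (e : rel T) k u w :
  within e k u w -> within (fun x y => e y x) k w u.
Proof.
elim: k u => [|k IH] u; first by rewrite /= eq_sym.
case/orP=> [/eqP->|/existsP[x /andP[ux xw]]]; first exact: within_refl.
rewrite -[k.+1]addn1; apply: within_trans (IH _ xw) _.
by apply: within1 ux.
Qed.

(** A walk shortens to a path without repeated vertices, which has fewer arcs than there are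
    vertices; this meets both restrictions built into [dist]. *)
Lemma dist_leP (T : finType) (e : rel T) (u w : T) (k : nat) :
  reflect (within e k u w) (dist e u w <= (k%:Z)%:E)%E.
Proof.
apply: (iffP idP) => [|/within_path[p [+ <-]]]; last first.
  case/shortenP=> p' ep' up' sub sp.
  have sp': size p' <= size p.
    by apply: uniq_leq_size sub; case/andP: up'.
  have lt: size p' < #|T|.
    by rewrite -[(size p').+1]/(size (u :: p')) cardE uniq_leq_size // => x;
      rewrite mem_enum.
  apply: (@bigmin_inf _ _ _ _ (Ordinal lt)).
    by apply/existsP; exists (in_tuple p'); rewrite ep' up' eqxx.
  by rewrite lee_fin lez_nat (leq_trans sp').
rewrite /dist; elim/big_rec: _ => [|d x /existsP[p /and3P[ep _ /eqP lp]] IH].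
  by rewrite leye_eq.
rewrite ge_min lee_fin lez_nat => /orP[dk|/IH//]; apply/within_path; exists p.
by rewrite size_tuple.
Qed.

Lemma diam_leP (T : finType) (e : rel T) (k : nat) :
  reflect (forall u w, within e k u w) (diam e <= (k%:Z)%:E)%E.
Proof.
apply: (iffP idP) => [dk u w|dk].
  apply/dist_leP; apply: le_trans dk.
  apply: le_trans (le_bigmax _ _ u); exact: (le_bigmax _ _ w).
have k0 : (0%:E <= (k%:Z)%:E :> \bar int)%E by rewrite lee_fin.
apply: bigmax_le => // u _; apply: bigmax_le => // w _; exact/dist_leP.
Qed.

(* A maximum cut among the colourings that extend [c0] off [U]. *)
Lemma ex_cut_coloring (T : finType) (e : rel T) (U : pred T) (c0 : T -> bool) :
  symmetric e -> irreflexive e ->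
  exists c : T -> bool,
    (forall z, ~~ U z -> c z = c0 z) /\
    (forall z w, U z -> e z w -> exists2 x, e z x & c x = ~~ c z).
Proof.
move=> e_sym e_irr.
pose ok (c : {ffun T -> bool}) := [forall z, ~~ U z ==> (c z == c0 z)].
pose cut (c : {ffun T -> bool}) := [set p : T * T | e p.1 p.2 && (c p.1 != c p.2)].
have ok0 : ok [ffun z => c0 z].
  by apply/forallP=> z; apply/implyP=> _; rewrite ffunE.
case: (arg_maxnP (fun c => #|cut c|) ok0) => c /forallP okc max_c.
exists c; split=> [z Uz|z w Uz zw]; first by apply/eqP; apply: (implyP (okc z)).
case: (boolP [exists x, e z x && (c x == ~~ c z)]) => [/existsP[x]|/existsPn no].
  by case/andP=> zx /eqP; exists x.
have mono x : e z x -> c x = c z.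
  by move=> zx; move: (no x); rewrite zx /=; case: (c x) (c z) => [] [].
pose c' := [ffun x => if x == z then ~~ c z else c x].
have okc' : ok c'.
  apply/forallP=> x; apply/implyP=> Ux; rewrite ffunE; case: (x =P z) => [xz|_].
    by rewrite xz Uz in Ux.
  exact: (implyP (okc x)).
have /= := max_c _ okc'; rewrite /geq /= leqNgt => /negP[].
apply: proper_card; apply/properP; split.
  apply/subsetP=> -[x y]; rewrite !inE /= !ffunE => /andP[xy ne]; rewrite xy /=.
  case: (x =P z) => [xz|_]; first by move: ne; rewrite xz in xy *;
    rewrite (mono _ xy) eqxx.
  case: (y =P z) => [yz|//].
  by move: ne; rewrite yz e_sym in xy *; rewrite (mono _ xy) eqxx.
exists (z, w); rewrite !inE /= ?zw /= ?(mono _ zw) ?eqxx // !ffunE eqxx.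
case: (w =P z) => [wz|_]; first by rewrite wz e_irr in zw.
by rewrite mono //; case: (c z).
Qed.

(** * Classification of the vertices around the path a - v - b *)

Section Orientation.
Variables (V : finType) (e : rel V) (v a b : V).
Hypotheses (e_sym : symmetric e) (e_irr : irreflexive e).
Hypothesis e_v : forall u, e v u = (u == a) || (u == b).
Hypotheses (a_neq_b : a != b) (ab_nonadj : ~~ e a b).
Hypothesis diam3 : forall u w, within e 3 u w.
Hypothesis deg_gt1 : forall u x, e u x -> exists2 y, e u y & y != x.
Hypothesis no_bridge : forall S : pred V, S a -> ~~ S b -> ~~ S v ->
  exists u w, [/\ S u, ~~ S w, w != v & e u w].

(* A side is a boolean, [false] for [a] and [true] for [b].  Exchanging the sides
   and reversing all arcs preserves the construction, so a lemma on [dir s] below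
   is about arcs towards [b] for [s = false] and about arcs from [a] for
   [s = true]. *)
Definition hub s := if s then b else a.
Definition near1 s z := e (hub s) z && ~~ e (hub (~~ s)) z.
Definition near2 z := [&& e a z, e b z & z != v].
Definition far z := [&& z != a, z != b, z != v, ~~ e a z & ~~ e b z].
Definition sees s z := [exists x, e z x && (near1 s x || near2 x)].
Definition far2 z := [&& far z, sees false z & sees true z].
Definition far1 s z := [&& far z, sees s z & ~~ sees (~~ s) z].
(* A gate can pass the flow on across; an idle vertex has no neighbour that could,
   and is served by a directed triangle through its hub. *)
Definition gate s z := near1 s z && (sees (~~ s) z || [exists m, e z m && far2 m]).
Definition has_far1 s z := [exists w, e z w && far1 s w].
Definition idle s z :=
  [&& near1 s z, ~~ gate s z, ~~ [exists x, e z x && gate s x] & ~~ has_far1 s z].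
(* A vertex adjacent to both [a]'s and [b]'s neighbourhoods only through one common
   neighbour of [a] and [b]: that edge must be used either to enter it or to leave
   it, and [tcol] below is true when it is used to leave. *)
Definition tied z :=
  far2 z && [exists c, near2 c && [forall x, e z x && ~~ far x ==> (x == c)]].
Definition good z := far2 z && ~~ tied z.
(** All far neighbours of such a vertex are tied as well, so nothing prescribes its colour and a
    maximum cut may choose it. *)
Definition tied_free z :=
  [&& tied z, ~~ has_far1 false z, ~~ has_far1 true z & ~~ [exists m, e z m && good m]].
Definition lone_b := [exists y, near1 true y && ~~ sees false y].

Lemma adj_va : e v a. Proof. by rewrite e_v eqxx. Qed.
Lemma adj_vb : e v b. Proof. by rewrite e_v eqxx orbT. Qed.
Lemma v_hub s : e v (hub s). Proof. by case: s; rewrite ?adj_va ?adj_vb. Qed.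
Lemma hub_v s : e (hub s) v. Proof. by rewrite e_sym v_hub. Qed.
Lemma v_neq_hub s : v != hub s.
Proof. by apply/eqP=> vh; have := v_hub s; rewrite -vh e_irr. Qed.
Lemma hub_nonadj s s' : e (hub s) (hub s') = false.
Proof. by case: s s' => [] []; rewrite /= ?e_irr ?(negPf ab_nonadj) // e_sym (negPf ab_nonadj). Qed.

Lemma near1_adj s x : near1 s x -> e (hub s) x. Proof. by case/andP. Qed.
Lemma near2_adj s x : near2 x -> e (hub s) x.
Proof. by case/and3P; case: s. Qed.
Lemma near1_far s x : near1 s x -> far x = false.
Proof. by case/andP=> h _; apply/negP=> /and5P[_ _ _]; case: s h => /= ->. Qed.
Lemma near2_far x : near2 x -> far x = false.
Proof. by case/and3P=> h _ _; apply/negP=> /and5P[_ _ _]; rewrite h. Qed.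
Lemma near1_near2 s x : near1 s x -> near2 x = false.
Proof.
by case/andP=> _ h; apply/negP=> /(near2_adj (~~ s)); rewrite (negPf h).
Qed.
Lemma near1_side s x : near1 s x -> near1 (~~ s) x = false.
Proof. by case/andP=> h _; rewrite /near1 negbK h andbF. Qed.
Lemma far2_far z : far2 z -> far z. Proof. by case/and3P. Qed.
Lemma far1_far s z : far1 s z -> far z. Proof. by case/and3P. Qed.
Lemma far2_sees s z : far2 z -> sees s z. Proof. by case/and3P; case: s. Qed.
Lemma far1_far2 s z : far1 s z -> far2 z = false.
Proof. by case/and3P=> _ _ h; apply/negP=> /(far2_sees (~~ s)); rewrite (negPf h). Qed.
Lemma far1_side s z : far1 s z -> far1 (~~ s) z = false.
Proof. by case/and3P=> _ h _; rewrite /far1 negbK h !andbF. Qed.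
Lemma hub_near1 s s' : near1 s (hub s') = false.
Proof. by rewrite /near1 hub_nonadj. Qed.
Lemma hub_near2 s : near2 (hub s) = false.
Proof. by apply/negP=> /(near2_adj s); rewrite hub_nonadj. Qed.
Lemma hub_far s : far (hub s) = false.
Proof. by case: s; rewrite /far eqxx ?andbF. Qed.
Lemma v_near1 s : near1 s v = false.
Proof. by rewrite /near1 !hub_v. Qed.
Lemma v_far : far v = false.
Proof. by rewrite /far eqxx !andbF. Qed.

Lemma near1_negb s s' x : near1 s x -> near1 s' x = (s == s').
Proof. by case: s s' => [] [] h; rewrite ?h // (near1_side h). Qed.
Lemma far1_negb s s' x : far1 s x -> far1 s' x = (s == s').
Proof. by case: s s' => [] [] h; rewrite ?h // (far1_side h). Qed.

Variant vertex_spec s z : Prop :=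
  | IsHub s' of z = hub s' | IsV of z = v | IsC of near2 z
  | IsS of near1 s z | IsOpp of near1 (~~ s) z | IsFar of far z.

Lemma vertex_cases s z : vertex_spec s z.
Proof.
case: (altP (z =P a)) => [->|za]; first exact: (@IsHub _ _ false).
case: (altP (z =P b)) => [->|zb]; first exact: (@IsHub _ _ true).
case: (altP (z =P v)) => [->|zv]; first by constructor 2.
case az: (e a z); case bz: (e b z).
- by constructor 3; rewrite /near2 az bz.
- by case: s; [constructor 5|constructor 4]; rewrite /near1 /= az bz.
- by case: s; [constructor 4|constructor 5]; rewrite /near1 /= az bz.
- by constructor 6; rewrite /far za zb zv az bz.
Qed.

Lemma far_hub s z : far z -> e (hub s) z = false.
Proof. by case/and5P=> _ _ _; case: s => /= /negPf h1 /negPf h2. Qed.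

Lemma far_nbr s z x : far z -> e z x -> [\/ near2 x, near1 s x, near1 (~~ s) x | far x].
Proof.
move=> fz zx; case: (vertex_cases s x) => [s' xh|xv|h|h|h|h].
- by move: zx; rewrite e_sym xh far_hub.
- move: zx fz; rewrite xv e_sym e_v => /orP[] /eqP->; first by rewrite (hub_far false).
  by rewrite (hub_far true).
- by constructor 1.
- by constructor 2.
- by constructor 3.
- by constructor 4.
Qed.

Lemma hub_nbr s x : e (hub s) x -> x != v -> near1 s x || near2 x.
Proof.
move=> hx xv; rewrite /near1 /near2 xv hx andbT /=.
by case: s hx => /= ->; rewrite ?andbT /=; case: (e _ x).
Qed.

Lemma seesI s z x : e z x -> near1 s x || near2 x -> sees s z.
Proof. by move=> zx h; apply/existsP; exists x; rewrite zx. Qed.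

(** The hubs are the only neighbours of [v], so a path of length at most 3 from [v] reaches [z]
    within two steps from some hub. *)
Lemma far_sees z : far z -> sees false z || sees true z.
Proof.
move=> fz; case: (within3P (diam3 v z)) => [vz|vz|[u vu uz]|[u [w [vu uw wz]]]].
- by rewrite -vz v_far in fz.
- by have := v_far; move: vz; rewrite e_v => /orP[] /eqP zh; move: fz;
  rewrite zh ?(hub_far false) ?(hub_far true).
- move: vu uz; rewrite e_v => /orP[] /eqP->; first by rewrite (far_hub false).
  by rewrite (far_hub true).
have wv : w != v.
  apply: contraTneq fz => wv; move: wz; rewrite wv e_v.
  by case/orP=> /eqP->; rewrite ?(hub_far false) ?(hub_far true).
rewrite e_sym in wz.
case: (altP (u =P a)) vu uw => [-> _ uw|_]; last rewrite e_v => /orP[/eqP-> |/eqP->] uw.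
- by rewrite (seesI wz (hub_nbr (s := false) uw wv)).
- by rewrite (seesI wz (hub_nbr (s := false) uw wv)).
- by rewrite orbC (seesI wz (hub_nbr (s := true) uw wv)).
Qed.

Lemma far_cases s z : far z -> [\/ far2 z, far1 s z | far1 (~~ s) z].
Proof.
move=> fz; have := far_sees fz; rewrite /far2 /far1 fz /=.
by case: s => /=; case: (sees false z); case: (sees true z) => //= _;
  [constructor 1|constructor 3|constructor 2|constructor 1|constructor 2|constructor 3].
Qed.

Lemma far1_nbr s z x : far1 s z -> e z x -> near1 s x \/ far x.
Proof.
case/and3P=> fz _ nz zx; case: (far_nbr s fz zx) => h; [|by left| |by right].
- by case/negP: nz; apply: seesI zx _; rewrite h orbT.
- by case/negP: nz; apply: seesI zx _; rewrite h.
Qed.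

Variant near1_nbr_spec s y : Prop :=
  | NbrHub of y = hub s | NbrS of near1 s y | NbrOpp of near1 (~~ s) y || near2 y
  | NbrM of far2 y | NbrT of far1 s y.

Lemma near1_nbr s x y : near1 s x -> e x y -> near1_nbr_spec s y.
Proof.
move=> xs xy; case: (vertex_cases s y) => [s' yh|yv|h|h|h|h].
- move: xy xs; rewrite yh e_sym => hx /andP[_ h]; constructor 1.
  by case: (s') (s) hx h => [] [] // -> .
- by move: xy xs; rewrite yv e_sym e_v => /orP[] /eqP->;
  rewrite ?(hub_near1 _ false) ?(hub_near1 _ true).
- by constructor 3; rewrite h orbT.
- by constructor 2.
- by constructor 3; rewrite h.
case: (far_cases s h) => h'; [by constructor 4|by constructor 5|].
case/and3P: h' => _ _ /negP[]; rewrite negbK.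
by rewrite e_sym in xy; apply: seesI xy _; rewrite xs.
Qed.

Lemma tied_far2 m : tied m -> far2 m. Proof. by case/andP. Qed.
Lemma good_far2 m : good m -> far2 m. Proof. by case/andP. Qed.
Lemma good_tied m : good m -> tied m = false. Proof. by case/andP=> _ /negPf. Qed.

Lemma tied_nearP m : tied m -> exists c, [/\ near2 c, e m c &
  forall x, e m x -> ~~ far x -> x = c].
Proof.
case/andP=> mM /existsP[c /andP[cC /forallP h]].
have hc x : e m x -> ~~ far x -> x = c.
  by move=> mx nx; apply/eqP; apply: (implyP (h x)); rewrite mx.
exists c; split=> //; case/existsP: (far2_sees false mM) => x /andP[mx hx].
rewrite -(hc x mx) //; case/orP: hx => hx; first by rewrite (near1_far hx).
by rewrite (near2_far hx).
Qed.

(** The only non-far neighbour of a tied vertex is adjacent to both hubs, which [x] is not. *)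
Lemma near1_far2_good s x m : near1 s x -> e m x -> far2 m -> good m.
Proof.
move=> xs mx mM; rewrite /good mM /=; apply/negP=> /tied_nearP[c [cC _ h]].
by move: cC; rewrite -(h x mx) ?(near1_far xs) // (near1_near2 xs).
Qed.

(** * Vertices with distance 2 to exactly one hub *)

Section TiedColoring.
Variable tcol : V -> bool.
(** A neighbour in [far1 false] needs the edge to the common neighbour as an exit towards [b], one
    in [far1 true] needs it as an entrance from [a]. If both occur, [lone_b] decides between
    them. *)
Hypothesis tcol_fixed : forall m, tied m -> ~~ tied_free m ->
  tcol m = has_far1 false m && (~~ has_far1 true m || ~~ lone_b).
Hypothesis tcol_cut : forall m m', tied_free m -> tied m' -> e m m' ->
  exists2 m'', e m m'' & tied m'' && (tcol m'' == ~~ tcol m).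

(* A direct vertex can pass the flow on to a far neighbour.  The others must turn
   back to a gate that sees the other side: a forked vertex can be entered from a
   second near neighbour, a stem cannot and needs help from a far neighbour, and a
   blocked vertex has no such gate. *)
Definition direct s z := far1 s z &&
  [exists u, e z u && [|| good u, far1 (~~ s) u | tied u && (tcol u == ~~ s)]].
Definition has_gate2 s z := [exists x, e z x && (near1 s x && sees (~~ s) x)].
Definition sole z := [exists x, [forall y, e z y && ~~ far y ==> (y == x)]].
Definition forked s z := [&& far1 s z, ~~ direct s z, has_gate2 s z & ~~ sole z].
Definition stem s z := [&& far1 s z, ~~ direct s z, has_gate2 s z & sole z].
Definition blocked s z := [&& far1 s z, ~~ direct s z & ~~ has_gate2 s z].
Definition iso s z := ~~ [exists w, e z w && stem s w].

(** * Levels, heights and the orientation *)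

Section Orient.
Variables (col : V -> bool) (outC : V -> V -> bool).
Hypothesis col_fixed : forall s x, near1 s x -> ~~ idle s x -> col x = false.
Hypothesis col_idle : forall s x y, idle s x -> near1 s y -> e x y ->
  exists2 y', e x y' & near1 s y' && (col y' == ~~ col x).
Hypothesis col_stem : forall s z w, stem s z -> stem s w -> e z w ->
  exists2 w', e z w' & stem s w' && (col w' == ~~ col z).
Hypothesis outC_tied : forall m c, tied m -> near2 c -> outC m c = tcol m.
Hypothesis outC_good : forall s m, good m -> exists2 x, e m x &
  near1 (~~ s) x || (near2 x && (outC m x (+) s)).

Definition pk s z := [pick x | e z x && (near1 s x && sees (~~ s) x)].
(** Direct and blocked vertices are only entered from their near neighbours. A forked vertex leaves
    through one chosen gate and is entered through its other near neighbours. The single near edge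
    of a stem follows its colour, or leads out if the stem has no stem neighbour. *)
Definition out s z x :=
  [&& far1 s z, ~~ direct s z, has_gate2 s z & if sole z then iso s z || col z else pk s z == Some x].
(* Within a level the arcs go upwards in [height]; [20 - height] is its mirror image,
   used on the side of [b].  Between two levels the direction of an edge is decided
   at its endpoint of higher level, [outward z x] meaning that it goes from [z]. *)
Definition near_height s x := if gate s x || col x then 2 else 0.
(** An isolated stem spends its near edge on leaving and must be entered from a far neighbour: 9
    exceeds the non-stems of its side, at most 6, and the tied vertices at 8. Stems of colour
    [false] pass to those of colour [true], from 4 to 5, and these as well as blocked vertices stay
    below direct ones. *)
Definition far_height s z := if blocked s z then 4 else
  if stem s z then (if iso s z then 9 else if col z then 5 else 4) else 6.
Definition height z :=
  if near1 false z then near_height false z else if near1 true z then 20 - near_height true z else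
  if far2 z then (if tied z then (if tcol z then 12 else 8) else 10) else
  if far1 false z then far_height false z else if far1 true z then 20 - far_height true z else 10.
Definition level z := if (z == a) || (z == b) then 0 else if far z then 2 else 1.
Definition outward z x :=
  if far z then
    if far2 z then (if near2 x then outC z x else near1 true x)
    else if far1 false z then out false z x else ~~ out true z x
  else if z == v then x == a else if near2 z then x == b
  else if near1 false z then col z else ~~ col z.
Definition orient u w := e u w &&
  (if level u == level w then height u < height w
    else if level w < level u then outward u w else ~~ outward w u).
Definition dir s u w := if s then orient w u else orient u w.
Definition sheight s z := if s then 20 - height z else height z.

Lemma orient_asym u w : orient u w -> ~~ orient w u.
Proof.
case/andP=> _; rewrite /orient; case: (ltngtP (level u) (level w)) => _.
- by move/negPf->; rewrite andbF.
- by move->; rewrite andbF.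
- by move=> h1; rewrite ltnNge (ltnW h1) andbF.
Qed.

Lemma dir_same s u w : e u w -> level u = level w -> sheight s u < sheight s w ->
  dir s u w.
Proof.
move=> uw l; rewrite /dir /sheight /orient; case: s => lt; rewrite -?l eqxx ?uw ?lt //.
by rewrite e_sym uw /=; lia.
Qed.

Lemma dir_down s u w : e u w -> level w < level u -> outward u w (+) s -> dir s u w.
Proof.
move=> uw l; rewrite /dir /orient; case: s; rewrite ?addbF ?addbT => ou.
  by rewrite e_sym uw (ltn_eqF l) ltnNge (ltnW l).
by rewrite uw l eq_sym (ltn_eqF l).
Qed.

Lemma dir_up s u w : e u w -> level u < level w -> ~~ (outward w u (+) s) -> dir s u w.
Proof.
move=> uw l; rewrite /dir /orient; case: s; rewrite ?addbF ?addbT ?negbK => ou.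
  by rewrite e_sym uw l eq_sym (ltn_eqF l).
by rewrite uw (ltn_eqF l) ltnNge (ltnW l).
Qed.

Lemma level_hub s : level (hub s) = 0.
Proof. by rewrite /level; case: s; rewrite eqxx ?orbT. Qed.
Lemma level_far z : far z -> level z = 2.
Proof.
move=> fz; rewrite /level fz; case: eqP => [zh|_].
  by move: fz; rewrite zh (hub_far false).
by case: eqP => // zh; move: fz; rewrite zh (hub_far true).
Qed.
Lemma level_near1 s x : near1 s x -> level x = 1.
Proof.
move=> xs; rewrite /level (near1_far xs); case: eqP => [zh|_].
  by move: xs; rewrite zh (hub_near1 s false).
by case: eqP => // zh; move: xs; rewrite zh (hub_near1 s true).
Qed.
Lemma level_near2 x : near2 x -> level x = 1.
Proof.
move=> xs; rewrite /level (near2_far xs); case: eqP => [zh|_].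
  by move: xs; rewrite zh (hub_near2 false).
by case: eqP => // zh; move: xs; rewrite zh (hub_near2 true).
Qed.
Lemma level_v : level v = 1.
Proof.
by rewrite /level v_far (negPf (v_neq_hub false)) (negPf (v_neq_hub true)).
Qed.

Lemma sheight_near1 s x : near1 s x -> sheight s x = near_height s x.
Proof.
rewrite /sheight /height; case: s => xs; rewrite ?xs //.
by rewrite (near1_negb false xs) /= subKn // /near_height; case: ifP.
Qed.
Lemma sheight_opp s x : near1 (~~ s) x -> sheight s x = 20 - near_height (~~ s) x.
Proof.
rewrite /sheight /height; case: s => /= xs; rewrite ?xs //.
by rewrite (near1_negb false xs).
Qed.
Lemma sheight_near2 s x : near2 x -> sheight s x = 10.
Proof.
move=> xC; rewrite /sheight /height.
have -> : near1 false x = false by apply/negP=> /near1_near2; rewrite xC.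
have -> : near1 true x = false by apply/negP=> /near1_near2; rewrite xC.
have -> : far2 x = false by apply/negP=> /far2_far; rewrite (near2_far xC).
have -> : far1 false x = false by apply/negP=> /far1_far; rewrite (near2_far xC).
have -> : far1 true x = false by apply/negP=> /far1_far; rewrite (near2_far xC).
by case: s.
Qed.
Lemma far_near1 s x : far x -> near1 s x = false.
Proof. by move=> fx; apply/negP=> /near1_far; rewrite fx. Qed.
Lemma sheight_far2 s m : far2 m ->
  sheight s m = if tied m then (if tcol m == s then 8 else 12) else 10.
Proof.
move=> mM; have fm := far2_far mM; rewrite /sheight /height !(far_near1 _ fm) mM.
by case: (tied m) (tcol m) s => [] [] [].
Qed.
Lemma sheight_far1 s z : far1 s z -> sheight s z = far_height s z.
Proof.
move=> zs; have fz := far1_far zs; rewrite /sheight /height !(far_near1 _ fz) (far1_far2 zs).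
case: s zs => zs; rewrite zs // (far1_negb false zs) /= subKn // /far_height.
by do 4 case: ifP => //.
Qed.
Lemma sheight_far1_opp s z : far1 (~~ s) z -> sheight s z = 20 - far_height (~~ s) z.
Proof.
move=> zs; have fz := far1_far zs; rewrite /sheight /height !(far_near1 _ fz) (far1_far2 zs).
by case: s zs => /= zs; rewrite zs // (far1_negb false zs).
Qed.

Lemma outward_v s : outward v (hub s) (+) s.
Proof.
rewrite /outward v_far eqxx; case: s => /=; rewrite ?eqxx //.
by rewrite eq_sym (negPf a_neq_b).
Qed.
Lemma outward_near2 s x : near2 x -> outward x (hub (~~ s)) (+) s.
Proof.
move=> xC; rewrite /outward (near2_far xC) xC.
have /negPf-> : x != v by case/and3P: xC.
by case: s => /=; rewrite ?eqxx // (negPf a_neq_b).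
Qed.
Lemma outward_near1 s x y : near1 s x -> outward x y (+) s = col x.
Proof.
move=> xs; rewrite /outward (near1_far xs) (near1_near2 xs).
have /negPf-> : x != v by apply/eqP=> xv; rewrite xv v_near1 in xs.
case: s xs => xs; rewrite ?xs ?addbF // (near1_negb false xs) /=.
by rewrite addbT negbK.
Qed.
Lemma outward_opp s x y : near1 (~~ s) x -> outward x y (+) s = ~~ col x.
Proof. by move/(@outward_near1 _ _ y); rewrite addbN => <-; rewrite negbK. Qed.
Lemma outward_far2_near1 s m x : far2 m -> near1 s x -> outward m x (+) s = false.
Proof.
move=> mM xs; rewrite /outward (far2_far mM) mM (near1_near2 xs) (near1_negb true xs).
by case: s {xs}.
Qed.
Lemma outward_far2_near2 m x : far2 m -> near2 x -> outward m x = outC m x.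
Proof. by move=> mM xC; rewrite /outward (far2_far mM) mM xC. Qed.
Lemma outward_far1 s z x : far1 s z -> outward z x (+) s = out s z x.
Proof.
move=> zs; rewrite /outward (far1_far zs) (far1_far2 zs) (far1_negb false zs).
by case: s {zs} => /=; rewrite ?addbF ?addbT ?negbK.
Qed.
Lemma outward_far1_opp s z x : far1 (~~ s) z -> outward z x (+) s = ~~ out (~~ s) z x.
Proof. by move/(@outward_far1 _ _ x); rewrite addbN => <-; rewrite negbK. Qed.

(** * Distances to the opposite hub *)

Lemma col_gate s x : gate s x -> col x = false.
Proof.
by move=> x1; apply: (@col_fixed s); rewrite /idle ?x1 ?andbF //; case/andP: x1.
Qed.
Lemma col_far1 s x z : near1 s x -> far1 s z -> e x z -> col x = false.
Proof.
move=> xs zs xz; apply: (@col_fixed s) => //; rewrite /idle.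
have -> : has_far1 s x by apply/existsP; exists z; rewrite xz.
by rewrite !andbF.
Qed.
Lemma gate_opp s x y : near1 s x -> e x y -> near1 (~~ s) y || near2 y -> gate s x.
Proof. by move=> xs xy h; rewrite /gate xs (seesI xy h). Qed.
Lemma gate_far2 s x m : near1 s x -> e x m -> far2 m -> gate s x.
Proof.
by move=> xs xm mM; rewrite /gate xs; apply/orP; right; apply/existsP; exists m;
  rewrite xm.
Qed.

(** For [s = true] the arcs of [dir s] are reversed, so this bounds a distance from [a] instead of
    one to [b]. Applied to a vertex of side [~~ s], it concerns the hub of that vertex's own
    side. *)
Local Notation exits s k z := (within (dir s) k z (hub (~~ s))).

Lemma dir_near2 s c : near2 c -> dir s c (hub (~~ s)).
Proof.
move=> cC; apply: dir_down; last exact: outward_near2.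
  by rewrite e_sym near2_adj.
by rewrite level_hub (level_near2 cC).
Qed.
Lemma dir_opp s y : near1 (~~ s) y -> ~~ col y -> dir s y (hub (~~ s)).
Proof.
move=> yt cy; apply: dir_down; last by rewrite (outward_opp _ yt).
  by rewrite e_sym near1_adj.
by rewrite level_hub (level_near1 yt).
Qed.
Lemma exits_near2 s k c : near2 c -> exits s k.+1 c.
Proof. by move=> cC; apply: within1; apply: dir_near2. Qed.
Lemma exits_opp0 s k y : near1 (~~ s) y -> ~~ col y -> exits s k.+1 y.
Proof. by move=> yt cy; apply: within1; apply: dir_opp. Qed.

(** Apart from its hub, an idle vertex has only neighbours in its own class, and at least one by the
    degree bound; the cut provides one of the opposite colour. Together with the hub the two form a
    directed triangle. *)
Lemma idle_partner s x : idle s x ->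
  exists y, [/\ e x y, near1 s y, col y = ~~ col x & ~~ gate s y].
Proof.
move=> xU; case/and4P: (xU) => xs x1 /existsPn xS1 /existsPn xT.
have hx : e x (hub s) by rewrite e_sym near1_adj.
have [y xy yh] := deg_gt1 hx.
have ys : near1 s y.
  case: (near1_nbr xs xy) => // h'.
  - by rewrite h' eqxx in yh.
  - by case/negP: x1; apply: gate_opp xy h'.
  - by case/negP: x1; apply: gate_far2 xy h'.
  - by have := xT y; rewrite xy h'.
have [y' xy' /andP[y's /eqP cy']] := col_idle xU ys xy.
by exists y'; split=> //; have := xS1 y'; rewrite xy'.
Qed.

Lemma col_colored_idle s x : near1 s x -> col x -> idle s x.
Proof. by move=> xs; apply: contraTT => /(col_fixed xs)->. Qed.

Lemma exits_opp s y : near1 (~~ s) y -> exits s 2 y.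
Proof.
move=> yt; case cy: (col y); last by apply: exits_opp0 => //; rewrite cy.
have [y0 [yy0 y0t cy0 y01]] := idle_partner (col_colored_idle yt cy).
have c0 : ~~ col y0 by rewrite cy0 cy.
apply: (within_step (x := y0)); last exact: exits_opp0.
apply: dir_same; rewrite ?(level_near1 yt) ?(level_near1 y0t) //
  (sheight_opp yt) (sheight_opp y0t).
by rewrite /near_height cy orbT (negPf y01) (negPf c0).
Qed.

Lemma home_idle s x : idle s x -> within (dir s) 2 x (hub s).
Proof.
have r1 y k : near1 s y -> col y -> within (dir s) k.+1 y (hub s).
  move=> ys cy; apply: within1; apply: dir_down; rewrite ?(outward_near1 _ ys) //.
    by rewrite e_sym near1_adj.
  by rewrite level_hub (level_near1 ys).
move=> xU; have xs : near1 s x by case/and4P: xU.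
have x1 : ~~ gate s x by case/and4P: xU.
case cx: (col x); first exact: r1.
have [y [xy ys cy y1]] := idle_partner xU; rewrite cx in cy.
apply: (within_step (x := y)); last exact: r1.
apply: dir_same; rewrite ?(level_near1 ys) ?(level_near1 xs) //
  (sheight_near1 xs) (sheight_near1 ys).
by rewrite /near_height cy cx orbT (negPf x1).
Qed.

Lemma exits_gate2 s x : near1 s x -> sees (~~ s) x -> exits s 2 x.
Proof.
move=> xs /existsP[y /andP[xy yh]].
have x1 : gate s x by apply: gate_opp xy _.
case/orP: (yh) => [yt|yC]; last first.
  apply: (within_step (x := y)); last exact: exits_near2.
  apply: dir_same; rewrite ?(level_near1 xs) ?(level_near2 yC) //
    (sheight_near1 xs) (sheight_near2 _ yC).
  by rewrite /near_height x1.
have cy : col y = false.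
  apply: (@col_gate (~~ s)); apply: gate_opp yt _ _; first by rewrite e_sym; exact: xy.
  by rewrite negbK xs.
apply: (within_step (x := y)); last by apply: exits_opp0; rewrite ?cy.
apply: dir_same; rewrite ?(level_near1 xs) ?(level_near1 yt) //
  (sheight_near1 xs) (sheight_opp yt).
by rewrite /near_height x1; case: ifP.
Qed.

Lemma level_far_near1 s z x : far z -> near1 s x -> level x < level z.
Proof. by move=> fz xs; rewrite (level_far fz) (level_near1 xs). Qed.
Lemma level_far_near2 z x : far z -> near2 x -> level x < level z.
Proof. by move=> fz xC; rewrite (level_far fz) (level_near2 xC). Qed.

Lemma dir_far2_opp s m x : far2 m -> near1 (~~ s) x -> e m x -> dir s m x.
Proof.
move=> mM xt mx; apply: dir_down => //; first exact: level_far_near1 (far2_far mM) xt.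
by have := outward_far2_near1 mM xt; rewrite addbN => /negbT; rewrite negbK.
Qed.
Lemma dir_near1_far2 s m x : far2 m -> near1 s x -> e x m -> dir s x m.
Proof.
move=> mM xs xm; apply: dir_up => //; first exact: level_far_near1 (far2_far mM) xs.
by rewrite (outward_far2_near1 mM xs).
Qed.
Lemma dir_far2_near2 s m c : far2 m -> near2 c -> e m c -> outC m c (+) s -> dir s m c.
Proof.
move=> mM cC mc oc; apply: dir_down => //;
  first exact: level_far_near2 (far2_far mM) cC.
by rewrite (outward_far2_near2 mM cC).
Qed.
Lemma dir_near1_far1 s z x : far1 s z -> near1 s x -> e x z -> ~~ out s z x ->
  dir s x z.
Proof.
move=> zs xs xz oz; apply: dir_up => //; first exact: level_far_near1 (far1_far zs) xs.
by rewrite (outward_far1 _ zs).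
Qed.
Lemma dir_far1_near1 s z x : far1 s z -> near1 s x -> e z x -> out s z x -> dir s z x.
Proof.
move=> zs xs xz oz; apply: dir_down => //;
  first exact: level_far_near1 (far1_far zs) xs.
by rewrite (outward_far1 _ zs).
Qed.
Lemma dir_far1_opp s w y : far1 (~~ s) w -> near1 (~~ s) y -> e w y ->
  ~~ out (~~ s) w y -> dir s w y.
Proof.
move=> wt yt wy ow; apply: dir_down => //;
  first exact: level_far_near1 (far1_far wt) yt.
by rewrite (outward_far1_opp _ wt).
Qed.

Lemma exits_good s m : good m -> exits s 2 m.
Proof.
move=> mg; have mM := good_far2 mg; have [x mx] := outC_good s mg.
case/orP=> [xt|/andP[xC oc]]; last first.
  by apply: (within_step (x := x)); [apply: dir_far2_near2|apply: exits_near2].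
apply: (within_step (x := x)); first exact: dir_far2_opp.
apply: exits_opp0 => //; rewrite (@col_gate (~~ s)) //.
by apply: gate_far2 xt _ mM; rewrite e_sym.
Qed.

Lemma exits_tied_out s m : tied m -> tcol m = ~~ s -> exits s 2 m.
Proof.
move=> mb cm; have [c [cC mc _]] := tied_nearP mb.
apply: (within_step (x := c)); last exact: exits_near2.
apply: (dir_far2_near2 (tied_far2 mb) cC mc).
by rewrite (outC_tied mb cC) cm addNb addbb.
Qed.

Lemma far1_sees_near1 s z : far1 s z -> exists2 x, e z x & near1 s x.
Proof.
move=> zs; case/and3P: (zs) => fz /existsP[x /andP[zx xh]] _.
exists x => //; case/orP: xh => // xC.
by case: (far1_nbr zs zx) => //; rewrite (near2_far xC).
Qed.

Lemma soleP s z x : near1 s x -> e z x -> sole z ->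
  forall y, e z y -> ~~ far y -> y = x.
Proof.
move=> xs zx /existsP[x0 /forallP h0] y zy ny.
have -> : x = x0 by apply/eqP; apply: (implyP (h0 x)); rewrite zx (near1_far xs).
by apply/eqP; apply: (implyP (h0 y)); rewrite zy.
Qed.

Lemma stem_near s z : stem s z ->
  exists x, [/\ e z x, near1 s x, sees (~~ s) x & forall y, e z y -> ~~ far y -> y = x].
Proof.
case/and4P=> zs _ /existsP[x /and3P[zx xs x2]] z1; exists x; split=> //.
exact: soleP xs zx z1.
Qed.

Lemma out_stem s z x : stem s z -> out s z x = iso s z || col z.
Proof. by case/and4P=> zs n1 h2 h1; rewrite /out zs n1 h2 h1. Qed.
Lemma out_direct s z x : direct s z -> out s z x = false.
Proof. by move=> z1; rewrite /out z1 andbF. Qed.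
Lemma out_blocked s z x : blocked s z -> out s z x = false.
Proof. by case/and3P=> _ _ /negPf h2; rewrite /out h2 /= !andbF. Qed.
Lemma out_forked s z x : forked s z -> out s z x = (pk s z == Some x).
Proof. by case/and4P=> zs n1 h2 /negPf h1; rewrite /out zs n1 h2 h1. Qed.

Lemma forked_pk s z : forked s z ->
  exists x, [/\ e z x, near1 s x, sees (~~ s) x & pk s z = Some x].
Proof.
case/and4P=> _ _ /existsP[x hx] _; rewrite /pk; case: pickP => [y|/(_ x)].
  by case/and3P=> *; exists y.
by rewrite hx.
Qed.

Variant far1_spec s z : Prop :=
  | TE1 of direct s z | TEa of forked s z | TEd of blocked s z | TPb of stem s z.
Lemma far1_cases s z : far1 s z -> far1_spec s z.
Proof.
move=> zs; case z1: (direct s z); first by constructor 1.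
case z2: (has_gate2 s z); last by constructor 3; rewrite /blocked zs z1 z2.
case z0: (sole z); first by constructor 4; rewrite /stem zs z1 z2.
by constructor 2; rewrite /forked zs z1 z2 z0.
Qed.
Lemma stem_far1 s z : stem s z -> far1 s z. Proof. by case/and4P. Qed.
Lemma direct_far1 s z : direct s z -> far1 s z. Proof. by case/andP. Qed.
Lemma forked_far1 s z : forked s z -> far1 s z. Proof. by case/and4P. Qed.
Lemma blocked_far1 s z : blocked s z -> far1 s z. Proof. by case/and3P. Qed.

Lemma exits_far1_out s w y : far1 (~~ s) w -> near1 (~~ s) y -> e w y ->
  ~~ out (~~ s) w y -> exits s 2 w.
Proof.
move=> wt yt wy ow; apply: (within_step (x := y)); first exact: dir_far1_opp.
by apply: exits_opp0; rewrite // (@col_far1 (~~ s) y w) // e_sym.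
Qed.

Lemma exits_direct_opp s w : direct (~~ s) w -> exits s 2 w.
Proof.
move=> w1; have wt := direct_far1 w1; have [y wy yt] := far1_sees_near1 wt.
by apply: exits_far1_out wt yt wy _; rewrite (out_direct _ w1).
Qed.
Lemma exits_blocked_opp s w : blocked (~~ s) w -> exits s 2 w.
Proof.
move=> w1; have wt := blocked_far1 w1; have [y wy yt] := far1_sees_near1 wt.
by apply: exits_far1_out wt yt wy _; rewrite (out_blocked _ w1).
Qed.
Lemma forked_other s z x : forked s z -> exists y, [/\ e z y, near1 s y & y != x].
Proof.
move=> za; have zs := forked_far1 za; case/and4P: za => _ _ _ /existsPn/(_ x)/forallPn[y].
rewrite negb_imply => /andP[/andP[zy ny] yx]; exists y; split=> //.
by case: (far1_nbr zs zy) => // fy; rewrite fy in ny.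
Qed.
Lemma exits_forked_opp s w : forked (~~ s) w -> exits s 2 w.
Proof.
move=> wa; have wt := forked_far1 wa; have [y0 [_ _ _ pky]] := forked_pk wa.
have [y [wy yt yy]] := forked_other y0 wa.
apply: exits_far1_out wt yt wy _; rewrite (out_forked _ wa) pky.
by apply: contra yy => /eqP[->].
Qed.
Lemma exits_stem_opp0 s w : stem (~~ s) w -> ~~ (iso (~~ s) w || col w) -> exits s 2 w.
Proof.
move=> wb ow; have wt := stem_far1 wb; have [y [wy yt _ _]] := stem_near wb.
by apply: exits_far1_out wt yt wy _; rewrite (out_stem _ wb).
Qed.

(** The remaining kinds of far neighbour would make the stem direct. *)
Lemma stem_nbr s z x : stem s z -> e z x ->
  [\/ near1 s x, far1 s x | tied x && (tcol x == s)].
Proof.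
move=> zb zx; have zs := stem_far1 zb; case: (far1_nbr zs zx) => [|fx];
  first by constructor 1.
have n1 : ~~ direct s z by case/and4P: zb.
have {}n1 u : e z u -> ~~ [|| good u, far1 (~~ s) u | tied u && (tcol u == ~~ s)].
  move=> zu; apply: contra n1 => h'; rewrite /direct zs /=; apply/existsP.
  by exists u; rewrite zu.
have := n1 _ zx; rewrite !negb_or => /and3P[h1 h2 h3].
case: (far_cases s fx) => h'; [|by constructor 2|by rewrite h' in h2].
constructor 3; move: h1 h3; rewrite /good h' /= negbK => -> /=.
by case: (tcol x) (s) => [] [].
Qed.

Lemma level_far1 s s' z w : far1 s z -> far1 s' w -> level z = level w.
Proof. by move=> /far1_far/level_far-> /far1_far/level_far->. Qed.
Lemma level_far1_far2 s z m : far1 s z -> far2 m -> level z = level m.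
Proof. by move=> /far1_far/level_far-> /far2_far/level_far->. Qed.
Lemma far_height_stem s z : stem s z -> far_height s z =
  if iso s z then 9 else if col z then 5 else 4.
Proof.
move=> zb; rewrite /far_height zb; case: ifP => // /and3P[_ _].
by case/and4P: zb => _ _ ->.
Qed.
Lemma far_height_direct s z : direct s z -> far_height s z = 6.
Proof.
move=> z1; rewrite /far_height; case: ifP => [/and3P[_ /negP//]|_].
by case: ifP => // /and4P[_ /negP].
Qed.
Lemma far_height_blocked s z : blocked s z -> far_height s z = 4.
Proof. by rewrite /far_height => ->. Qed.
Lemma far_height_nonstem s z : far1 s z -> ~~ stem s z -> far_height s z <= 6.
Proof. by move=> zs /negPf nb; rewrite /far_height nb; case: ifP. Qed.

Lemma exits_nonstem_opp s w : far1 (~~ s) w -> ~~ stem (~~ s) w -> exits s 2 w.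
Proof.
move=> wt; case: (far1_cases wt) => [w1|w1|w1|-> //] _.
- exact: exits_direct_opp.
- exact: exits_forked_opp.
- exact: exits_blocked_opp.
Qed.

(** Two steps suffice unless the near edge of a stem has the wrong direction. Then one more step
    leads to a stem of the other colour or, if there is no stem neighbour, to another far
    neighbour. *)
Lemma exits_far1_opp s w : far1 (~~ s) w -> exits s 3 w.
Proof.
move=> wt; have p23 u : exits s 2 u -> exits s 3 u by apply: within_mono.
case: (boolP (stem (~~ s) w)) => [wb|nb]; last exact: p23 (exits_nonstem_opp wt nb).
case: (boolP (iso (~~ s) w)) => [wi|]; last first.
  move=> wni; case cw: (col w); last by apply/p23/exits_stem_opp0; rewrite ?cw ?orbF.
  case/negPn/existsP: (wni) => w' /andP[ww' w'b].
  have [w0 ww0 /andP[w0b /eqP cw0]] := col_stem wb w'b ww'.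
  have w0i : ~~ iso (~~ s) w0.
    by rewrite negbK; apply/existsP; exists w; rewrite e_sym ww0.
  have w0t := stem_far1 w0b.
  apply: (within_step (x := w0)); last first.
    by apply: exits_stem_opp0; rewrite // (negPf w0i) cw0 cw.
  apply: dir_same; rewrite ?(level_far1 wt w0t) //
    (sheight_far1_opp wt) (sheight_far1_opp w0t).
  by rewrite !far_height_stem // (negPf wni) (negPf w0i) cw0 cw.
(* [y] is the only near neighbour, so the second neighbour [x] given by the degree bound is far. It
   lies above 11 = 20 - 9. *)
have [y [wy yt _ yu]] := stem_near wb; have [x wx xy] := deg_gt1 wy.
have hw : sheight s w = 11 by rewrite (sheight_far1_opp wt) far_height_stem // wi.
case: (stem_nbr wb wx) => [xt|xt|/andP[xb /eqP cx]].
- by rewrite (yu x) ?(near1_far xt) ?eqxx in xy.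
- have xnb : ~~ stem (~~ s) x by move/existsPn: wi => /(_ x); rewrite wx.
  apply: (within_step (x := x)); last exact: exits_nonstem_opp.
  apply: dir_same; rewrite ?(level_far1 wt xt) // hw (sheight_far1_opp xt).
  by apply: leq_trans (leq_sub2l 20 (far_height_nonstem xt xnb)).
- apply: (within_step (x := x)); last exact: exits_tied_out.
  have xM := tied_far2 xb; apply: dir_same;
    rewrite ?(level_far1_far2 wt xM) // hw (sheight_far2 _ xM) xb cx.
  by case: (s).
Qed.

(** If the prescribed colour makes the common neighbour useless for leaving in direction [s], this
    supplies a far neighbour to leave through. *)
Lemma tied_free_tcol s m : tied m -> ~~ tied_free m -> tcol m = s ->
  (exists2 w, e m w & far1 (~~ s) w) \/ (exists2 m', e m m' & good m').
Proof.
move=> mb nU cm; have := tcol_fixed mb nU; rewrite cm => cs.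
case: (boolP (has_far1 (~~ s) m)) => [/existsP[w /andP[mw wt]]|nt]; first by left;
  exists w.
right; case: (boolP [exists m', e m m' && good m']) => [/existsP[m' /andP[]]|ng].
  by exists m'.
case/negP: nU; rewrite /tied_free mb ng andbT /=.
by case: s cs nt {cm} => /=; case: (has_far1 false m); case: (has_far1 true m).
Qed.

(** For [tcol m = s] the edge to the common neighbour points the wrong way. The first step then goes
    up to a far neighbour that exits in two steps: a direct one, a good one, or a tied one of the
    other colour. *)
Lemma exits_tied s m : tied m -> exits s 3 m.
Proof.
move=> mb; have mM := tied_far2 mb.
case: (altP (tcol m =P s)) => [cm|ncm]; last first.
  by apply: within_mono (exits_tied_out mb _) => //; case: (tcol m) (s) ncm => [] [].
have hm : sheight s m = 8 by rewrite (sheight_far2 _ mM) mb cm eqxx.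
case: (boolP (tied_free m)) => [mU|nU]; last first.
  case: (tied_free_tcol mb nU cm) => [[w mw wt]|[m' mm' m'g]].
    have w1 : direct (~~ s) w.
      rewrite /direct wt; apply/existsP; exists m; rewrite e_sym mw mb negbK cm eqxx.
      by rewrite !orbT.
    apply: (within_step (x := w)); last exact: exits_direct_opp.
    apply: dir_same; rewrite -?(level_far1_far2 wt mM) // hm (sheight_far1_opp wt).
    by rewrite (far_height_direct w1).
  have m'M := good_far2 m'g; apply: (within_step (x := m')); last exact: exits_good.
  apply: dir_same; rewrite ?(level_far (far2_far _)) // hm (sheight_far2 _ m'M).
  by rewrite (good_tied m'g).
(* A neighbour other than [c] is far, hence tied because [m] is free; so the cut property of [tcol]
   applies. *)
have [c [cC mc cu]] := tied_nearP mb; have [x mx xc] := deg_gt1 mc.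
have fx : far x by apply: contraNT xc => nx; rewrite (cu x).
case/and4P: (mU) => _ /existsPn n1 /existsPn n2 /existsPn n3.
have xb : tied x.
  case: (far_cases false fx) => h'; last first.
  - by have := n2 x; rewrite mx h'.
  - by have := n1 x; rewrite mx h'.
  - by have := n3 x; rewrite mx /good h' negbK.
have [m' mm' /andP[m'b /eqP cm']] := tcol_cut mU xb mx; rewrite cm in cm'.
have m'M := tied_far2 m'b; apply: (within_step (x := m')); last exact: exits_tied_out.
apply: dir_same; rewrite ?(level_far (far2_far _)) // hm (sheight_far2 _ m'M) m'b cm'.
by case: (s).
Qed.

Lemma exits_direct s z : direct s z -> exits s 3 z.
Proof.
move=> z1; have zs := direct_far1 z1; have hz : sheight s z =
  6 by rewrite (sheight_far1 zs) far_height_direct.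
case/andP: (z1) => _ /existsP[u /andP[zu /or3P[ug|ut|/andP[ub /eqP cu]]]].
- have uM := good_far2 ug; apply: (within_step (x := u)); last exact: exits_good.
  apply: dir_same; rewrite ?(level_far1_far2 zs uM) // hz (sheight_far2 _ uM).
  by rewrite (good_tied ug).
- have u1 : direct (~~ s) u.
    by rewrite /direct ut; apply/existsP; exists z; rewrite e_sym zu negbK zs orbT.
  apply: (within_step (x := u)); last exact: exits_direct_opp.
  by apply: dir_same; rewrite ?(level_far1 zs ut) // hz (sheight_far1_opp ut) far_height_direct.
- have uM := tied_far2 ub; apply: (within_step (x := u)); last exact: exits_tied_out.
  apply: dir_same; rewrite ?(level_far1_far2 zs uM) // hz (sheight_far2 _ uM) ub cu.
  by case: (s).
Qed.

Lemma exits_forked s z : forked s z -> exits s 3 z.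
Proof.
move=> za; have zs := forked_far1 za; have [x [zx xs x2 pkx]] := forked_pk za.
apply: (within_step (x := x)); last exact: exits_gate2.
by apply: dir_far1_near1; rewrite ?(out_forked _ za) ?pkx.
Qed.

Lemma exits_stem1 s z : stem s z -> iso s z || col z -> exits s 3 z.
Proof.
move=> zb oz; have zs := stem_far1 zb; have [x [zx xs x2 _]] := stem_near zb.
apply: (within_step (x := x)); last exact: exits_gate2.
by apply: dir_far1_near1; rewrite ?(out_stem _ zb).
Qed.

Lemma stem_partner s z : stem s z -> ~~ iso s z -> ~~ col z ->
  exists w, [/\ stem s w, ~~ iso s w, col w & dir s z w].
Proof.
move=> zb zni /negPf cz; have zs := stem_far1 zb.
case/negPn/existsP: (zni) => w' /andP[zw' w'b].
have [w zw /andP[wb /eqP cw]] := col_stem zb w'b zw'; rewrite cz in cw.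
have wni : ~~ iso s w by rewrite negbK; apply/existsP; exists z; rewrite e_sym zw.
have ws := stem_far1 wb; exists w; split=> //.
apply: dir_same; rewrite ?(level_far1 zs ws) //
  (sheight_far1 zs) (sheight_far1 ws) !far_height_stem //.
by rewrite (negPf zni) (negPf wni) cz cw.
Qed.

(** No neighbour of [z] is adjacent to the opposite hub, so the path of length at most 3 to that hub
    has length exactly 3, and its second vertex is the required [u]. *)
Lemma far1_exit s z : far1 s z -> exists u, e z u /\
  [|| near1 s u && sees (~~ s) u, far2 u | far1 (~~ s) u].
Proof.
move=> zs; have fz := far1_far zs.
have far1_h u : e z u -> e u (hub (~~ s)) = false.
  move=> zu; case: (far1_nbr zs zu) => [/andP[_ /negPf]|/far_hub];
    rewrite e_sym => -> //.
case: (within3P (diam3 z (hub (~~ s)))) => [zh|zh|[u zu uh]|[u [w [zu uw wh]]]].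
- by rewrite zh hub_far in fz.
- by move: zh; rewrite e_sym far_hub.
- by rewrite far1_h in uh.
have wv : w != v.
  apply: contraTneq zu => wv; move: uw; rewrite wv e_sym e_v => /orP[] /eqP->.
    by rewrite e_sym (far_hub false).
  by rewrite e_sym (far_hub true).
rewrite e_sym in wh; have hw := seesI uw (hub_nbr wh wv).
exists u; split=> //; rewrite hw andbT.
case: (far1_nbr zs zu) => [->//|fu]; case: (far_cases s fu) => [->|/and3P[_ _]|->].
- by rewrite orbT.
- by rewrite hw.
- by rewrite !orbT.
Qed.

(** Being blocked excludes every way across from [far1_exit] except a tied neighbour whose colour
    does not let the flow leave to the common neighbour. *)
Lemma blocked_exit s z : blocked s z -> exists m, [/\ e z m, tied m & tcol m = s].
Proof.
case/and3P=> zs n1 n2; have [u [zu hu]] := far1_exit zs.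
have : ~~ [|| good u, far1 (~~ s) u | tied u && (tcol u == ~~ s)].
  by apply: contra n1 => h'; rewrite /direct zs; apply/existsP; exists u; rewrite zu.
rewrite !negb_or => /and3P[ug /negPf ut ub].
case/or3P: hu => hu; last by rewrite ut in hu.
  by case/negP: n2; apply/existsP; exists u; rewrite zu.
have mb : tied u by move: ug; rewrite /good hu negbK.
by exists u; split=> //; move: ub; rewrite mb /=; case: (tcol u) (s) => [] [].
Qed.

Lemma dir_blocked_tied s z m : blocked s z -> e z m -> tied m -> tcol m =
  s -> dir s z m.
Proof.
move=> zd zm mb cm; have zs := blocked_far1 zd; have mM := tied_far2 mb.
by apply: dir_same; rewrite ?(level_far1_far2 zs mM) //
  (sheight_far1 zs) (far_height_blocked zd) (sheight_far2 _ mM) mb cm eqxx.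
Qed.

Lemma exits_blocked s z : blocked s z -> exits s 4 z.
Proof.
move=> zd; have [m [zm mb cm]] := blocked_exit zd.
by apply: (within_step (x := m)); [apply: dir_blocked_tied|apply: exits_tied].
Qed.

Lemma exits_gate s x : gate s x -> exits s 3 x.
Proof.
case/andP=> xs /orP[x2|/existsP[m /andP[xm mM]]].
  by apply: within_mono (exits_gate2 xs x2).
apply: (within_step (x := m)); first exact: dir_near1_far2.
by apply: exits_good; apply: near1_far2_good xs _ mM; rewrite e_sym.
Qed.

Lemma dir_near1_gate s x y : near1 s x -> ~~ gate s x -> ~~ col x -> e x y ->
  gate s y -> dir s x y.
Proof.
move=> xs /negPf x1 /negPf cx xy y1; have ys : near1 s y by case/andP: y1.
apply: dir_same; rewrite ?(level_near1 xs) ?(level_near1 ys) //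
  (sheight_near1 xs) (sheight_near1 ys).
by rewrite /near_height x1 cx y1.
Qed.

(* This is what the role of [lone_b] in [tcol_fixed] is made for: it holds on both
   sides. *)
Lemma blocked_opp s z : blocked s z -> exists y, near1 (~~ s) y /\ ~~ sees s y.
Proof.
move=> zd; have zs := blocked_far1 zd; have [m [zm mb cm]] := blocked_exit zd.
have ms : has_far1 s m by apply/existsP; exists z; rewrite e_sym zm.
have nU : ~~ tied_free m by move: ms; rewrite /tied_free; case: (s) => ->;
  rewrite ?andbF.
have := tcol_fixed mb nU; rewrite cm.
have B3P : lone_b -> exists y, near1 true y /\ ~~ sees false y.
  by case/existsP=> y /andP[]; exists y.
case: s zd zs ms {cm} => zd zs ms; rewrite ms /=; last first.
  by move/esym/negbT; rewrite negb_or !negbK => /andP[_ /B3P].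
case: (has_far1 false m) => //= /esym n3.
(* For [s = true] the colour of [m] forces [~~ lone_b], while a near neighbour of [z] witnesses
   [lone_b]: no vertex is blocked on the side of [b]. *)
have [x zx xs] := far1_sees_near1 zs; case/negP: n3; apply/existsP; exists x.
rewrite xs /=; case/and3P: zd => _ _; apply: contra => x2; apply/existsP.
by exists x; rewrite zx xs.
Qed.

Lemma far1_opp s z y : far1 s z -> near1 (~~ s) y -> e z y = false.
Proof.
move=> zs yt; apply/negP=> /(far1_nbr zs)[ys|fy].
  by rewrite (near1_side ys) in yt.
by rewrite far_near1 in yt.
Qed.

(** If [x] is no gate and has no adjacent gate, it has a neighbour [z] in [far1 s]. A direct or
    forked [z] is entered from [x] and exits in three steps, the chosen gate of a forked [z] being
    different from [x]. A stem [z] would make [x] a gate. *)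
Lemma exits_nonidle s x : near1 s x -> ~~ idle s x -> exits s 4 x.
Proof.
move=> xs nU; case: (boolP (gate s x)) => [x1|x1].
  exact: within_mono (exits_gate x1).
have cx : ~~ col x by rewrite (col_fixed xs nU).
case: (boolP [exists y, e x y && gate s y]) => [/existsP[y /andP[xy y1]]|nS].
  by apply: (within_step (x := y)); [apply: dir_near1_gate|apply: exits_gate].
have {}nU : has_far1 s x by move: nU; rewrite /idle xs x1 nS /= negbK.
move/existsPn: nS => nS.
have good z : e x z -> direct s z -> exits s 4 x.
  move=> xz z1; apply: (within_step (x := z)); last exact: exits_direct.
  by apply: dir_near1_far1 (direct_far1 z1) xs xz _; rewrite (out_direct _ z1).
case/existsP: nU => z /andP[xz zs]; case: (far1_cases zs) => h'.
- exact: good h'.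
- apply: (within_step (x := z)); last exact: exits_forked.
  have [y [_ ys y2 pky]] := forked_pk h'.
  apply: (dir_near1_far1 zs xs xz); rewrite (out_forked _ h') pky.
  by apply: contra x1 => /eqP[<-]; rewrite /gate ys y2.
(* Since [y] has no neighbour at [hub s], a path of length at most 3 from [x] to [y] must be x, u,
   w, y with [u] in [far1 s] and [w] good or in [far1 (~~ s)]. Thus [u] is a direct neighbour of [x]
   and replaces [z]. *)
- have [y [yt ny]] := blocked_opp h'.
  have no_near1 w : near1 s w || near2 w -> e w y -> False.
    by move=> hw wy; case/negP: ny; apply: seesI hw; rewrite e_sym.
  have no_hub : e (hub s) y = false.
    by case/andP: yt => _; rewrite negbK => /negPf.
  have xC u : e x u -> [\/ u = hub s, near1 s u /\ ~~ gate s u | far1 s u].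
    move=> xu; case: (near1_nbr xs xu) => h1.
    - by constructor 1.
    - by constructor 2; split=> //; have := nS u; rewrite xu.
    - by case/negP: x1; apply: gate_opp xu h1.
    - by case/negP: x1; apply: gate_far2 xu h1.
    - by constructor 3.
  case: (within3P (diam3 x y)) => [xy|xy|[u xu uy]|[u [w [xu uw wy]]]].
  + by rewrite -xy (near1_side xs) in yt.
  + by case: (no_near1 x); rewrite ?xs.
  + case: (xC u xu) => [uh|[us _]|us].
    * by rewrite uh no_hub in uy.
    * by case: (no_near1 u); rewrite ?us.
    * by rewrite (far1_opp us yt) in uy.
  have wv : w != v.
    apply: contraTneq wy => ->; rewrite e_v negb_or.
    by apply/andP; split; apply: contraTneq yt => ->;
      rewrite ?(hub_near1 _ false) ?(hub_near1 _ true).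
  case: (xC u xu) => [uh|[us u1]|us].
  + by case: (no_near1 w); rewrite // hub_nbr // -uh.
  + case: (near1_nbr us uw) => h1.
    * by rewrite h1 no_hub in wy.
    * by case: (no_near1 w); rewrite ?h1.
    * by case/negP: u1; apply: gate_opp uw h1.
    * by case/negP: u1; apply: gate_far2 uw h1.
    * by rewrite (far1_opp h1 yt) in wy.
  apply: (good u xu); rewrite /direct us; apply/existsP; exists w; rewrite uw /=.
  case: (far1_nbr us uw) => [ws|fw]; first by case: (no_near1 w); rewrite ?ws.
  case: (far_cases s fw) => h1.
  + by rewrite (near1_far2_good yt wy h1).
  + by rewrite (far1_opp h1 yt) in wy.
  + by rewrite h1 orbT.
- have [y [_ ys y2 yu]] := stem_near h'.
  case/negP: x1; rewrite (yu x); first by rewrite /gate ys y2.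
    by rewrite e_sym.
  by rewrite (near1_far xs).
Qed.

Definition lagging s x := [&& near1 s x, ~~ gate s x, ~~ idle s x & ~~ has_gate2 s x].
(* The vertices that may need four steps; in [late'] a stem of colour [false] is
   replaced by its partner of colour [true]. *)
Definition late s z := [|| lagging s z, stem s z && ~~ (iso s z || col z) | blocked s z].
Definition late' s z := [|| lagging s z, [&& stem s z, ~~ iso s z & col z] | blocked s z].

(** To be used with [s = false] at the start of a walk and, with arcs reversed, with [s = true] at
    its end. *)
Lemma source_cases s z :
  [\/ within (dir s) 2 z (hub s), exits s 3 z | exits s 4 z /\ late s z].
Proof.
case: (vertex_cases s z) => [s' ->|->|zC|zs|zt|fz].
- case: (altP (s' =P s)) => [->|ns]; first by constructor 1; apply: within_refl.
  have -> : s' = ~~ s by case: (s') (s) ns => [] [].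
  by constructor 2; apply: within_refl.
- constructor 1; apply: within1; apply: dir_down (v_hub s) _ (outward_v s).
  by rewrite level_hub level_v.
- by constructor 2; apply: exits_near2.
- case: (boolP (gate s z)) => [/exits_gate|z1]; first by constructor 2.
  case: (boolP (idle s z)) => [/home_idle|zU]; first by constructor 1.
  case: (boolP (has_gate2 s z)) => [|z2]; last first.
    by constructor 3; split; [apply: exits_nonidle|rewrite /late /lagging zs z1 zU z2].
  case/existsP=> y /and3P[zy ys y2]; constructor 2.
  apply: (within_step (x := y)); last exact: exits_gate2.
  by apply: dir_near1_gate; rewrite ?(col_fixed zs zU) // /gate ys y2.
- by constructor 2; apply: within_mono (exits_opp zt).
case: (far_cases s fz) => [zM|zs|zt]; last by constructor 2; apply: exits_far1_opp.
  constructor 2; case: (boolP (tied z)) => [/exits_tied//|nb].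
  by apply: within_mono (exits_good s _) => //; rewrite /good zM.
case: (far1_cases zs) => h'.
- by constructor 2; apply: exits_direct.
- by constructor 2; apply: exits_forked.
- by constructor 3; split; [apply: exits_blocked|rewrite /late h' !orbT].
case: (boolP (iso s z || col z)) => [oz|noz]; first by constructor 2;
  apply: exits_stem1.
constructor 3; split; last by rewrite /late h' noz orbT.
move: (noz); rewrite negb_or => /andP[zni cz].
have [w [wb _ cw zw]] := stem_partner h' zni cz.
by apply: within_step zw _; apply: exits_stem1; rewrite // cw orbT.
Qed.

Lemma late_step s z : late s z -> exists2 z', late' s z' & within (dir s) 1 z z'.
Proof.
case/or3P=> [h'|/andP[zb]|h'].
- by exists z; rewrite ?within_refl // /late' h'.
- rewrite negb_or => /andP[zni cz]; have [w [wb wni cw zw]] := stem_partner zb zni cz.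
  by exists w; rewrite ?within1 // /late' wb wni cw orbT.
- by exists z; rewrite ?within_refl // /late' h' !orbT.
Qed.

(* The second vertex of a path of length 3 from one side's [late'] vertex to the
   other's: the first two cases have no continuation, the others follow the flow. *)
Variant next_spec s z u : Prop :=
  | NextHub of u = hub s
  | NextDead of near1 s u & ~~ sees (~~ s) u
  | NextS2 of near1 s u & sees (~~ s) u & dir s z u
  | NextT of far1 s u & (direct s u -> dir s z u)
  | NextMb of tied u & tcol u = s & dir s z u.

Lemma late_next s z u : late' s z -> e z u -> next_spec s z u.
Proof.
case/or3P=> [/and4P[zs z1 zU /existsPn z2]|/and3P[zb zni cz]|zd] zu.
- case: (near1_nbr zs zu) => h'.
  + by constructor 1.
  + by constructor 2; have := z2 u; rewrite // zu h'.
  + by case/negP: z1; apply: gate_opp zu h'.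
  + by case/negP: z1; apply: gate_far2 zu h'.
  + constructor 4 => // u1; apply: dir_near1_far1 => //.
    by rewrite (out_direct _ u1).
- have zs := stem_far1 zb; have hz : sheight s z = 5.
    by rewrite (sheight_far1 zs) far_height_stem // (negPf zni) cz.
  case: (stem_nbr zb zu) => [us|us|/andP[ub /eqP cu]].
  + have [x [zx xs x2 xu]] := stem_near zb; have ux : u =
    x by rewrite (xu u) ?(near1_far us).
    constructor 3; rewrite ?ux //; apply: dir_far1_near1 => //.
    by rewrite (out_stem _ zb) cz orbT.
  + constructor 4 => // u1; apply: dir_same;
    rewrite ?(level_far1 zs us) // hz (sheight_far1 us).
    by rewrite far_height_direct.
  + have uM := tied_far2 ub; constructor 5 => //.
    by apply: dir_same; rewrite ?(level_far1_far2 zs uM) // hz (sheight_far2 _ uM) ub cu eqxx.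
have zs := blocked_far1 zd; case/and3P: (zd) => _ n1 /existsPn n2.
have {}n1 : ~~ [|| good u, far1 (~~ s) u | tied u && (tcol u == ~~ s)].
  by apply: contra n1 => h'; rewrite /direct zs; apply/existsP; exists u; rewrite zu.
move: n1; rewrite !negb_or => /and3P[ug ut ub].
case: (far1_nbr zs zu) => [us|fu].
  by constructor 2; have := n2 u; rewrite // zu us.
case: (far_cases s fu) => h'; last by rewrite h' in ut.
  have mb : tied u by move: ug; rewrite /good h' negbK.
  have cu : tcol u = s by move: ub; rewrite mb /=; case: (tcol u) (s) => [] [].
  by constructor 5 => //; apply: dir_blocked_tied.
constructor 4 => // u1; apply: dir_same; rewrite ?(level_far1 zs h') //
  (sheight_far1 zs) (sheight_far1 h').
by rewrite (far_height_blocked zd) far_height_direct.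
Qed.

Lemma dir_negb s u w : dir (~~ s) u w = dir s w u.
Proof. by case: s. Qed.

Lemma tied_near1 s m x : tied m -> near1 s x -> e m x = false.
Proof.
move=> mb xs; apply/negP=> mx; have := near1_far2_good xs mx (tied_far2 mb).
by rewrite /good mb andbF.
Qed.

Lemma late_class s z : late' s z -> near1 s z \/ far1 s z.
Proof.
case/or3P=> [/andP[]|/and3P[/stem_far1]|/blocked_far1]; by [left|right].
Qed.

(** The classes of the two ends exclude a path of length at most 2 in the graph, so there is one of
    length 3. Applying [late_next] from both ends, its outer edges follow the flow or lead to a dead
    end. The middle edge joins vertices of equal level and goes upwards in height, and it makes any
    [far1] vertex on it direct. *)
Lemma late_meet s z w : late' s z -> late' (~~ s) w -> within (dir s) 3 z w.
Proof.
move=> zl wl.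
have wn u : e u w -> next_spec (~~ s) w u by rewrite e_sym; apply: late_next.
have D3 u u' : dir s z u -> dir s u u' -> dir (~~ s) w u' -> within (dir s) 3 z w.
  rewrite dir_negb => zu uu' u'w.
  exact: within_step zu (within_step uu' (within1 _ u'w)).
have near1_far1 x t : near1 s x -> far1 (~~ s) t -> e x t = false.
  by move=> xs tt; rewrite e_sym (far1_opp tt) // negbK.
have near1_hub x : near1 s x -> e x (hub (~~ s)) = false.
  by case/andP=> _ /negPf; rewrite e_sym.
have hub_y y : near1 (~~ s) y -> e (hub s) y = false.
  by case/andP=> _; rewrite negbK => /negPf.
have hub_far1 u : far u -> e (hub s) u = false by apply: far_hub.
have far1_hub u : far u -> e u (hub (~~ s)) = false by rewrite e_sym; apply: far_hub.
case: (within3P (diam3 z w)) => [zw|zw|[u zu uw]|[u [u' [zu uu' u'w]]]].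
- rewrite zw in zl; case: (late_class zl) (late_class wl) => h1 [] h2.
  + by rewrite (near1_side h1) in h2.
  + by rewrite (far_near1 _ (far1_far h2)) in h1.
  + by rewrite (far_near1 _ (far1_far h1)) in h2.
  + by rewrite (far1_side h1) in h2.
- case: (late_next zl zw) => [wh|ws _|ws _ _|ws _|wb _ _]; case: (late_class wl) => h2.
  + by rewrite wh hub_near1 in h2.
  + by have := far1_far h2; rewrite wh hub_far.
  + by rewrite (near1_side ws) in h2.
  + by rewrite (far_near1 _ (far1_far h2)) in ws.
  + by rewrite (near1_side ws) in h2.
  + by rewrite (far_near1 _ (far1_far h2)) in ws.
  + by rewrite (far_near1 _ (far1_far ws)) in h2.
  + by rewrite (far1_side ws) in h2.
  + by rewrite (far_near1 _ (far2_far (tied_far2 wb))) in h2.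
  + by have := far1_far2 h2; rewrite (tied_far2 wb).
- have uS : near1 s u -> next_spec (~~ s) w u -> False.
    move=> us; case=> [h1|h1 _|h1 _ _|h1 _|h1 _ _].
    + by rewrite h1 hub_near1 in us.
    + by rewrite (near1_side us) in h1.
    + by rewrite (near1_side us) in h1.
    + by rewrite (far_near1 _ (far1_far h1)) in us.
    + by rewrite (far_near1 _ (far2_far (tied_far2 h1))) in us.
  case: (late_next zl zu) => [uh|us _|us _ _|us _|ub cu _].
  + move: uw; rewrite uh; case: (late_class wl) => [/hub_y->//|/far1_far/hub_far1->//].
  + by case: (uS us (wn u uw)).
  + by case: (uS us (wn u uw)).
  + case: (wn u uw) => [h1|h1 _|h1 _ _|h1 _|h1 _ _].
    * by have := far1_far us; rewrite h1 hub_far.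
    * by rewrite (far_near1 _ (far1_far us)) in h1.
    * by rewrite (far_near1 _ (far1_far us)) in h1.
    * by rewrite (far1_side us) in h1.
    * by have := far1_far2 us; rewrite (tied_far2 h1).
  + case: (wn u uw) => [h1|h1 _|h1 _ _|h1 _|h1 c1 _].
    * by have := far2_far (tied_far2 ub); rewrite h1 hub_far.
    * by rewrite (far_near1 _ (far2_far (tied_far2 ub))) in h1.
    * by rewrite (far_near1 _ (far2_far (tied_far2 ub))) in h1.
    * by have := far1_far2 h1; rewrite (tied_far2 ub).
    * by rewrite cu in c1; case: (s) c1.
have far1_direct u1 t1 : far1 s u1 -> far1 (~~ s) t1 -> e u1 t1 -> direct s u1.
  by move=> us tt ut; rewrite /direct us; apply/existsP; exists t1; rewrite ut tt orbT.
case: (late_next zl zu) => [uh|us u2|us u2 Du|us Du|ub cu Du].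
- move: uu'; rewrite uh; case: (wn u' u'w) => [->|h1 _|h1 _ _|h1 _|h1 _ _].
  + by rewrite hub_nonadj.
  + by rewrite hub_y.
  + by rewrite hub_y.
  + by rewrite hub_far1 ?(far1_far h1).
  + by rewrite hub_far1 ?(far2_far (tied_far2 h1)).
- case: (wn u' u'w) => [h1|h1 _|h1 _ _|h1 _|h1 _ _].
  + by rewrite h1 near1_hub in uu'.
  + by case/negP: u2; apply: seesI uu' _; rewrite h1.
  + by case/negP: u2; apply: seesI uu' _; rewrite h1.
  + by rewrite near1_far1 in uu'.
  + by rewrite e_sym (tied_near1 h1 us) in uu'.
- case: (wn u' u'w) => [h1|h1 n1|h1 _ Du'|h1 _|h1 _ _].
  + by rewrite h1 near1_hub in uu'.
  + by case/negP: n1; rewrite negbK; apply: (@seesI _ _ u); rewrite 1?e_sym // us.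
  + apply: (D3 u u') => //; apply: dir_same;
    rewrite ?(level_near1 us) ?(level_near1 h1) //.
    by rewrite (sheight_near1 us) (sheight_opp h1) /near_height; do 2 case: ifP.
  + by rewrite near1_far1 in uu'.
  + by rewrite e_sym (tied_near1 h1 us) in uu'.
- case: (wn u' u'w) => [h1|h1 _|h1 _ _|h1 Du'|h1 cu' Du'].
  + by rewrite h1 far1_hub ?(far1_far us) in uu'.
  + by rewrite (far1_opp us h1) in uu'.
  + by rewrite (far1_opp us h1) in uu'.
  + have u1 := far1_direct _ _ us h1 uu'.
    have u'1 : direct (~~ s) u'.
      by rewrite /direct h1; apply/existsP; exists u; rewrite e_sym uu' negbK us orbT.
    apply: (D3 u u'); [exact: Du| |exact: Du'].
    apply: dir_same; rewrite ?(level_far1 us h1) //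
      (sheight_far1 us) (sheight_far1_opp h1) !far_height_direct //.
  + have u1 : direct s u.
      by rewrite /direct us; apply/existsP; exists u'; rewrite uu' h1 cu' eqxx !orbT.
    have u'M := tied_far2 h1; apply: (D3 u u'); [exact: Du| |exact: Du'].
    apply: dir_same; rewrite ?(level_far1_far2 us u'M) //
      (sheight_far1 us) (sheight_far2 _ u'M) far_height_direct //.
    by rewrite h1 cu'; case: (s).
have uM := tied_far2 ub.
case: (wn u' u'w) => [h1|h1 _|h1 _ _|h1 Du'|h1 cu' Du'].
- by rewrite h1 far1_hub ?(far2_far uM) in uu'.
- by rewrite (tied_near1 ub h1) in uu'.
- by rewrite (tied_near1 ub h1) in uu'.
- have u'1 : direct (~~ s) u'.
    rewrite /direct h1; apply/existsP; exists u; rewrite e_sym uu' negbK ub cu eqxx.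
    by rewrite !orbT.
  apply: (D3 u u'); [exact: Du| |exact: Du'].
  apply: dir_same; rewrite -?(level_far1_far2 h1 uM) //
    (sheight_far2 _ uM) (sheight_far1_opp h1) far_height_direct //.
  by rewrite ub cu eqxx.
- have u'M := tied_far2 h1; apply: (D3 u u'); [exact: Du| |exact: Du'].
  apply: dir_same; rewrite ?(level_far (far2_far _)) //
    (sheight_far2 _ uM) (sheight_far2 _ u'M).
  by rewrite ub h1 cu cu' eqxx; case: (s).
Qed.

(** The cut around [a] and its private neighbours is crossed by an edge avoiding [v]. Either it
    leads from [a] to a common neighbour, giving two steps, or it starts at a vertex that is not
    idle, one step after [a] and at most four before [b]. *)
Lemma orient_hubs : within orient 5 a b.
Proof.
pose S := [pred z | (z == a) || near1 false z].
have Sb : ~~ S b by rewrite /= negb_or eq_sym a_neq_b (hub_near1 false true).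
have Sv : ~~ S v by rewrite /= negb_or (v_neq_hub false) v_near1.
have Sa : S a by rewrite /= eqxx.
have [u [w [/= uS wS wv uw]]] := no_bridge Sa Sb Sv.
move: wS; rewrite negb_or => /andP[wa ws].
case/orP: uS => [/eqP uh|us].
  rewrite uh in uw; have := hub_nbr (s := false) uw wv; rewrite (negPf ws) /= => wC.
  have aw : orient a w := dir_near2 true wC.
  exact: within_step aw (@exits_near2 false 3 w wC).
have nU : ~~ idle false u.
  apply/negP=> /and4P[_ /negP u1 _ /existsPn uT].
  case: (near1_nbr us uw) => h'.
  - by rewrite h' eqxx in wa.
  - by rewrite h' in ws.
  - by case: u1; apply: gate_opp uw h'.
  - by case: u1; apply: gate_far2 uw h'.
  - by have := uT w; rewrite uw h'.
have cu : ~~ col u by rewrite (col_fixed us nU).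
have au : orient a u := @dir_opp true u us cu.
exact: within_step au (exits_nonidle us nU).
Qed.

Lemma orient_within z w : within orient 9 z w.
Proof.
have ba : within orient 2 b a.
  have lt s : level (hub s) < level v by rewrite level_v level_hub.
  have bv : orient b v := dir_down adj_vb (lt true) (outward_v true).
  have va' : orient v a := dir_down adj_va (lt false) (outward_v false).
  exact: within_step bv (within1 0 va').
have rev k x y : within (dir true) k x y -> within orient k y x by move/within_rev.
(* The extreme sums are 2 + 5 + 2 through a and then b, and 3 + 2 + 4 or 4 + 2 + 3 through b, v, a.
   Two late ends meet in 1 + 3 + 1 steps. *)
case: (source_cases false z) => [za|zb|[zb zl]];
  case: (source_cases true w) => [/rev bw|/rev aw|[/rev aw wl]].
- exact: within_trans za (within_trans orient_hubs bw).
- exact: within_mono (within_trans za aw).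
- exact: within_mono (within_trans za aw).
- exact: within_mono (within_trans zb bw).
- exact: within_mono (within_trans zb (within_trans ba aw)).
- exact: within_mono (within_trans zb (within_trans ba aw)).
- exact: within_mono (within_trans zb bw).
- exact: within_mono (within_trans zb (within_trans ba aw)).
have [z' z'l zz'] := late_step zl; have [w' w'l /rev w'w] := late_step wl.
exact: within_mono (within_trans zz' (within_trans (late_meet z'l w'l) w'w)).
Qed.

End Orient.
End TiedColoring.

(** * Existence of the colourings and of the directions at common neighbours *)

Lemma ex_tcol : exists tcol : V -> bool,
  (forall m, tied m -> ~~ tied_free m -> tcol m =
    has_far1 false m && (~~ has_far1 true m || ~~ lone_b)) /\
  (forall m m', tied_free m -> tied m' -> e m m' ->
    exists2 m'', e m m'' & tied m'' && (tcol m'' == ~~ tcol m)).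
Proof.
(* Restricting the graph to tied vertices makes the neighbour across the cut tied. *)
pose e' u w := [&& e u w, tied u & tied w].
have e'_sym : symmetric e' by move=> u w; rewrite /e' e_sym andbCA andbC andbA andbAC -andbA.
have e'_irr : irreflexive e' by move=> u; rewrite /e' e_irr.
have [c [c1 c2]] := ex_cut_coloring tied_free
  (fun m => has_far1 false m && (~~ has_far1 true m || ~~ lone_b)) e'_sym e'_irr.
exists c; split=> [m _|m m' mU m'b mm']; first exact: c1.
have mb : tied m by case/andP: mU.
have [|x /and3P[mx _ xb] /eqP cx] := c2 m m' mU; first by rewrite /e' mm' mb.
by exists x; rewrite // xb.
Qed.

(** One maximum cut serves idle vertices and stems of both sides, because only edges inside a class
    [near1 s] or [stem tcol s] are kept and these classes are disjoint. *)
Lemma ex_col tcol : exists col : V -> bool,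
  [/\ forall s x, near1 s x -> ~~ idle s x -> col x = false,
      forall s x y, idle s x -> near1 s y -> e x y ->
        exists2 y', e x y' & near1 s y' && (col y' == ~~ col x) &
      forall s z w, stem tcol s z -> stem tcol s w -> e z w ->
        exists2 w', e z w' & stem tcol s w' && (col w' == ~~ col z)].
Proof.
pose e' u w := e u w &&
  [exists s, (near1 s u && near1 s w) || (stem tcol s u && stem tcol s w)].
pose U z := [exists s, idle s z || stem tcol s z].
have e'_sym : symmetric e'.
  move=> u w; rewrite /e' e_sym; congr (_ && _); apply: eq_existsb => s.
  by rewrite andbC; congr (_ || _); rewrite andbC.
have e'_irr : irreflexive e' by move=> u; rewrite /e' e_irr.
have [c [c1 c2]] := ex_cut_coloring U (fun _ => false) e'_sym e'_irr.
have SPb s s' x : near1 s x -> stem tcol s' x = false.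
  by move=> xs; apply/negP=> /stem_far1/far1_far; rewrite (near1_far xs).
exists c; split=> [s x xs xU|s x y xU ys xy|s z w zb wb zw].
- apply: c1; apply: contra xU => /existsP[s' /orP[xU|xb]];
  last by rewrite (SPb s) in xb.
  by have := near1_negb s' xs; case/and4P: (xU) => -> _ _ _ /esym/eqP ->.
- have xs : near1 s x by case/and4P: xU.
  have Ux : U x by apply/existsP; exists s; rewrite xU.
  have [|y' /andP[xy' /existsP[s' sheight']] /eqP cy] := c2 x y Ux.
    by rewrite /e' xy; apply/existsP; exists s; rewrite xs ys.
  move: sheight'; rewrite (near1_negb s' xs) (SPb s) // orbF => /andP[/eqP<- y's].
  by exists y'; rewrite // y's.
have zs := stem_far1 zb; have Uz : U z by apply/existsP; exists s; rewrite zb orbT.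
have [|y' /andP[xy' /existsP[s' sheight']] /eqP cy] := c2 z w Uz.
  by rewrite /e' zw; apply/existsP; exists s; rewrite zb wb orbT.
move: sheight'; rewrite (far_near1 _ (far1_far zs)) /= => /andP[zs' y'b].
have ss' : s == s' by rewrite -(far1_negb s' zs) (stem_far1 zs').
by exists y'; rewrite // (eqP ss') y'b.
Qed.

(** A good vertex must be both entered and left by an edge to a neighbour of the hubs. A private
    neighbour of one hub takes one role and the common neighbours the other. With common neighbours
    only there are at least two, since the vertex is not tied; one picked neighbour is for entering,
    the others for leaving. *)
Lemma ex_outC (tcol : V -> bool) : exists outC : V -> V -> bool,
  (forall m c, tied m -> near2 c -> outC m c = tcol m) /\
  (forall s m, good m -> exists2 x, e m x &
     near1 (~~ s) x || (near2 x && (outC m x (+) s))).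
Proof.
pose touches s m := [exists x, e m x && near1 s x].
pose outC m c := if tied m then tcol m else if touches false m then true else
  if touches true m then false else Some c != [pick c | e m c && near2 c].
exists outC; split=> [m c mb _|s m mg]; first by rewrite /outC mb.
have mM := good_far2 mg.
case: (boolP (touches (~~ s) m)) => [/existsP[x /andP[mx xt]]|nt]; first by exists x;
  rewrite ?xt.
case/existsP: (far2_sees (~~ s) mM) => x /andP[mx].
case/orP=> [xt|xC]; first by case/negP: nt; apply/existsP; exists x; rewrite mx.
case: (boolP (touches s m)) => [sheight|ns].
  exists x => //; rewrite xC /outC (good_tied mg) /=.
  by case: s sheight nt => /= sheight /negPf nt; rewrite sheight ?nt ?orbT.
have n0 : touches false m = false by case: (s) nt ns => /= /negPf h1 /negPf h2.
have n1 : touches true m = false by case: (s) nt ns => /= /negPf h1 /negPf h2.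
rewrite /outC (good_tied mg) n0 n1.
case: pickP => [c /andP[mc cC]|/(_ x)]; last by rewrite mx xC.
case: s nt ns => _ _; first by exists c; rewrite // cC eqxx orbT.
case/andP: mg => _; rewrite /tied mM /= => /existsPn/(_ c); rewrite cC /=.
case/forallPn=> y; rewrite negb_imply => /andP[/andP[my ny] yc].
exists y => //; have yC : near2 y.
  case: (far_nbr false (far2_far mM) my) => // h'; last by rewrite h' in ny.
  - by move/existsPn: n0 => /(_ y); rewrite my h'.
  - by move/existsPn: n1 => /(_ y); rewrite my h'.
rewrite yC addbF orbC /=; apply/orP; left.
by apply: contra yc => /eqP[->].
Qed.

Lemma ex_orientation : exists orient : rel V,
  [/\ forall u w, orient u w -> e u w, forall u w, orient u w -> ~~ orient w u &
      forall u w, within orient 9 u w].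
Proof.
have [tcol [m1 m2]] := ex_tcol; have [col [c1 c2 c3]] := ex_col tcol.
have [outC [o1 o2]] := ex_outC tcol.
exists (orient tcol col outC); split=> [u w /andP[]//|u w|u w];
  first exact: orient_asym.
exact: orient_within.
Qed.

End Orientation.

(** * Degree sum when all vertices of degree 2 lie in triangles *)

Section TriangleCount.
Variables (V : finType) (e : rel V).
Hypotheses (e_sym : symmetric e) (e_irr : irreflexive e).
Hypothesis diam3 : forall u w, within e 3 u w.
Hypothesis bridgeless : forall (x y : V) (S : pred V), e x y -> S x -> ~~ S y ->
  exists u w, [/\ S u, ~~ S w, e u w & (u, w) != (x, y)].
Hypothesis gt1 : 1 < #|V|.

Definition nbrs z : {set V} := [set w | e z w].

Lemma deg_gt1 u x : e u x -> exists2 y, e u y & y != x.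
Proof.
move=> ux; have ne : ~~ pred1 u x by apply/eqP=> xu; rewrite xu e_irr in ux.
have [u' [w [/= /eqP-> _ uw ne']]] := @bridgeless u x (pred1 u) ux (eqxx u) ne.
by exists w => //; apply: contra ne' => /eqP->.
Qed.

Lemma nbrs_gt1 u : 1 < #|nbrs u|.
Proof.
have [w wu] : exists w, w != u.
  apply/existsP; apply: contraLR gt1; rewrite negb_exists -leqNgt => /forallP h.
  by rewrite -(card1 u); apply/subset_leq_card/subsetP=> w _; have := h w;
    rewrite negbK.
have [x ux] : exists x, e u x.
  case/orP: (diam3 u w) => [/eqP uw|/existsP[x /andP[ux _]]]; last by exists x.
  by rewrite uw eqxx in wu.
have [y uy yx] := deg_gt1 ux.
have <- : #|[set x; y]| = 2 by rewrite cards2 eq_sym yx.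
by apply: subset_leq_card; apply/subsetP=> z /set2P[]->; rewrite inE.
Qed.

Hypothesis triangles : forall u x y, nbrs u = [set x; y] -> e x y.

(** Let [v] have degree 2. Each vertex of degree 2 in [L2] lacks one unit, which it receives from a
    neighbour in [L1]. The vertices of [L1] keep degree 2 each and obtain the third unit from the
    degrees of [a] and [b]. In total 2 + 4 + 3|L1| + 3|L2| = 3n - 3. *)
Lemma degree_sum_triangles : 3 * #|V| <= \sum_(z : V) #|nbrs z| + 3.
Proof.
case: (boolP [exists v, #|nbrs v| == 2]) => [/existsP[v /cards2P[a [b [ab vE]]]]|];
  last first.
  rewrite negb_exists => /forallP h.
  rewrite -sum1_card big_distrr /= -[X in X <= _]addn0 leq_add //.
  by apply: leq_sum => z _; have := h z; have := nbrs_gt1 z; lia.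
have va : e v a by have := set21 a b; rewrite -vE inE.
have vb : e v b by have := set22 a b; rewrite -vE inE.
have eab : e a b by apply: triangles vE.
have neq x y : e x y -> x != y by apply: contraTneq => ->; rewrite e_irr.
pose L1 z := [&& z != v, z != a, z != b & e a z || e b z].
pose L2 z := [&& z != v, z != a, z != b & ~~ (e a z || e b z)].
have split_sum (F : V -> nat) : \sum_z F z =
    F v + F a + F b + \sum_(z | L1 z) F z + \sum_(z | L2 z) F z.
  rewrite (bigD1 v) //= (bigD1 a) ?[a == v]eq_sym ?neq //=.
  rewrite (bigD1 b) ?[b == v]eq_sym ?[b == a]eq_sym ?neq //=.
  rewrite (bigID (fun z => e a z || e b z)) /= !addnA.
  by congr (_ + _ + _); apply: eq_bigl => z; rewrite /L1 /L2 -!andbA.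
pose d2 z : bool := L2 z && (#|nbrs z| == 2).
pose k x := #|[set w in nbrs x | d2 w]|.
(* If this fails for some [k x > 0], the neighbours of [x] are one vertex [c] of {a, b} and the set
   [K] of its neighbours counted by [k]. Each vertex of [K] lies in a triangle with [x] whose third
   vertex is again in [K], so xc would be the only edge leaving {x} and [K]. *)
have L1_deg x : L1 x -> 2 + k x <= #|nbrs x|.
  case/and4P=> xv xa xb xab.
  case: (posnP (k x)) => [->|k_gt0]; first by rewrite addn0 nbrs_gt1.
  have [c [xc cab]] : exists c, e x c /\ c \in [set a; b].
    by case/orP: xab; [exists a|exists b]; rewrite e_sym !inE eqxx ?orbT.
  have c_far w : d2 w -> e w c = false.
    case/andP=> /and4P[_ _ _]; rewrite negb_or => /andP[/negPf wa /negPf wb] _.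
    by rewrite e_sym; case/set2P: cab => ->.
  have cd2 : ~~ d2 c.
    by case/set2P: cab => ->; rewrite /d2 /L2 eqxx ?andbF.
  rewrite leqNgt; apply/negP=> lt.
  pose K := [set w in nbrs x | d2 w].
  have cK : c \notin K by rewrite inE (negPf cd2) andbF.
  have sub : c |: K \subset nbrs x.
    by apply/subsetP=> w; rewrite !inE => /orP[/eqP->//|/andP[]].
  have xE : c |: K = nbrs x.
    by apply/eqP; rewrite eqEcard sub cardsU1 cK -ltnS.
  pose S := [pred w | (w == x) || (w \in K)].
  have Sc : ~~ S c by rewrite /= negb_or cK andbT eq_sym neq.
  have [u [w [/= uS wS uw ne]]] := @bridgeless x c S xc (predU1l _ (erefl x)) Sc.
  move: wS; rewrite negb_or => /andP[wx wK].
  case/orP: uS => [/eqP ux|uK].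
    have : w \in c |: K by rewrite xE inE -ux.
    case/setU1P=> [wc|wK']; first by rewrite ux wc eqxx in ne.
    by rewrite wK' in wK.
  have ux : e u x by move: uK; rewrite !inE e_sym => /andP[].
  have u2 : d2 u by move: uK; rewrite inE => /andP[].
  case/andP: (u2) => _ /cards2P[p [q [_ uE]]].
  have epq : e p q by apply: triangles uE.
  have : x \in [set p; q] by rewrite -uE inE.
  have : w \in [set p; q] by rewrite -uE inE.
  move=> wpq xpq; have xw : e x w.
    case/set2P: wpq wx => ->; case/set2P: xpq => ->; rewrite ?eqxx // => _ //.
    by rewrite e_sym.
  have : w \in c |: K by rewrite xE inE.
  case/setU1P=> [wc|wK']; first by have := c_far _ u2; rewrite -wc uw.
  by rewrite wK' in wK.
(* Vertices of [L2] have distance 3 from [v], so each has a neighbour in [L1]; the rest is double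
   counting. *)
have k_sum : \sum_(z | d2 z) 1 <= \sum_(x | L1 x) k x.
  under [X in _ <= X]eq_bigr => x _ do rewrite /k -sum1_card.
  under [X in _ <= X]eq_bigr => x _ do rewrite big_mkcond /=.
  rewrite exchange_big /= [X in X <= _]big_mkcond /=; apply: leq_sum => w _.
  case: (boolP (d2 w)) => [w2|//]; case/andP: (w2) => /and4P[wv wa wb wab] _.
  have [x xL xw] : exists2 x, L1 x & e x w.
    case: (within3P (diam3 v w)) => [vw|vw|[u vu uw]|[u [x [vu ux xw]]]].
    - by rewrite vw eqxx in wv.
    - have : w \in [set a; b] by rewrite -vE inE.
      by rewrite !inE (negPf wa) (negPf wb).
    - have : u \in [set a; b] by rewrite -vE inE.
      by move=> /set2P[] uE; rewrite -uE uw ?orbT in wab.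
    exists x => //; have uab : u \in [set a; b] by rewrite -vE inE.
    have xab : e a x || e b x by case/set2P: uab => <-; rewrite ux ?orbT.
    rewrite /L1 xab andbT; apply/and3P; split.
    - apply: contraTneq xw => ->; apply/negP=> vw.
      have : w \in [set a; b] by rewrite -vE inE.
      by rewrite !inE (negPf wa) (negPf wb).
    - by apply: contraNneq wab => <-; rewrite xw.
    - by apply: contraNneq wab => <-; rewrite xw orbT.
  rewrite (bigD1 x) //= !inE xw w2 //.
(* The 4 counts [v] twice and the edge ab from both ends. *)
have ab_deg : 4 + \sum_(z | L1 z) 1 <= #|nbrs a| + #|nbrs b|.
  have deg c c' : e v c -> e c c' -> v != c' -> ~~ L1 c' ->
      2 + #|[set z | L1 z && e c z]| <= #|nbrs c|.
    move=> vc cc' vc' c'L; set A := [set z | _].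
    have vA : v \notin c' |: A by rewrite !inE /L1 eqxx (negPf vc').
    have c'A : c' \notin A by rewrite inE (negPf c'L).
    have -> : 2 + #|A| = #|v |: (c' |: A)| by rewrite !cardsU1 vA c'A addnA.
    apply: subset_leq_card; apply/subsetP=> z; rewrite !inE.
    by case/or3P=> [/eqP->|/eqP->|/andP[]] //; rewrite e_sym.
  have := deg a b va eab (neq _ _ vb); rewrite {1}/L1 eqxx !andbF => /(_ isT) da.
  have := deg b a vb; rewrite e_sym eab (neq _ _ va) {1}/L1 eqxx !andbF.
  move=> /(_ isT isT isT) db.
  apply: leq_trans (leq_add da db); rewrite addnACA leq_add2l.
  rewrite sum1_card -cardsUI; apply: leq_trans (leq_addr _ _).
  apply: subset_leq_card; apply/subsetP=> z zL; rewrite !inE -andb_orr.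
  by have {}zL : L1 z := zL; rewrite zL; case/and4P: zL.
have L2_deg : \sum_(z | L2 z) 3 <= \sum_(z | L2 z) #|nbrs z| + \sum_(z | d2 z) 1.
  rewrite [X in _ + X]big_mkcondr -big_split /=; apply: leq_sum => z _.
  by have := nbrs_gt1 z; case: eqP => /=; lia.
have L1_sum : \sum_(x | L1 x) 2 + \sum_(x | L1 x) k x <= \sum_(x | L1 x) #|nbrs x|.
  by rewrite -big_split; apply: leq_sum.
have nE : #|V| = 3 + \sum_(z | L1 z) 1 + \sum_(z | L2 z) 1.
  by rewrite -sum1_card split_sum.
have e2 : \sum_(z | L1 z) 2 = 2 * \sum_(z | L1 z) 1 by rewrite big_distrr.
have e3 : \sum_(z | L2 z) 3 = 3 * \sum_(z | L2 z) 1 by rewrite big_distrr.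
have v2 : #|nbrs v| = 2 by rewrite vE cards2 ab.
by rewrite split_sum nE v2; move: ab_deg k_sum L2_deg L1_sum; rewrite e2 e3; lia.
Qed.

End TriangleCount.

(** * Edge-disjoint paths under deletion of one edge *)

Definition same_edge (T : eqType) (x y : T * T) : bool :=
  (x == y) || (x == (y.2, y.1)).

Definition path_edges (T : Type) (u : T) (p : seq T) : seq (T * T) := zip (u :: p) p.

Definition edge_disjoint (T : eqType) (u : T) (p q : seq T) : bool :=
  all (fun x => all (fun y => ~~ same_edge x y) (path_edges u q)) (path_edges u p).

Lemma set2_inj (T : finType) (x y z w : T) :
  [set x; y] = [set z; w] -> same_edge (x, y) (z, w).
Proof.
move=> h; rewrite /same_edge !xpair_eqE /=.
have hx : x \in [set z; w] by rewrite -h set21.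
have hy : y \in [set z; w] by rewrite -h set22.
have hz : z \in [set x; y] by rewrite h set21.
have hw : w \in [set x; y] by rewrite h set22.
case/set2P: hx hz hw => ->; case/set2P: hy => ->; rewrite ?eqxx ?orbT // !inE !orbb.
  by move=> _ /eqP->; rewrite eqxx.
by move=> /eqP->; rewrite eqxx.
Qed.

Section TwoPaths.
Variables (G : sgraph) (S : {set {set G}}) (S1 : #|S| <= 1).

Lemma del_path (u : G) p : path (@adj G) u p ->
  all (fun x => [set x.1; x.2] \notin S) (path_edges u p) ->
    path (@adj (del_edges S)) u p.
Proof.
elim: p u => //= x p IH u /andP[ux xp] /andP[uS pS].
by rewrite /del_adj ux uS IH.
Qed.

(** If both paths were hit, the single deleted edge would belong to both. *)
Lemma two_paths (u : G) p q : path (@adj G) u p -> path (@adj G) u q ->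
  edge_disjoint u p q ->
  path (@adj (del_edges S)) u p \/ path (@adj (del_edges S)) u q.
Proof.
move=> up uq pq.
case: (boolP (all (fun x => [set x.1; x.2] \notin S) (path_edges u p))) => hp.
  by left; apply: del_path.
right; apply: del_path => //; apply/allP=> -[z w] zw; apply/negP=> zwS.
case/allPn: hp => -[x y] xy; rewrite negbK /= => xyS.
have E : [set x; y] = [set z; w] :> {set G}.
  by move/card_le1_eqP: S1 => /(_ _ _ xyS zwS).
by have := allP (allP pq _ xy) _ zw; rewrite (set2_inj E).
Qed.

End TwoPaths.

(** * Glued 5-cycles as members of the class *)

Section Extremal.
Variables (m t : nat).

(** The [t + 1] vertices [mid] are joined to both hubs; each index [i] contributes a path of length
    3 from [hub2 false] to [hub2 true] through its two vertices [pend]. *)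
Definition xvertex : finType := (('I_t.+1 + bool) + ('I_m.+1 * bool))%type.
Definition mid (k : 'I_t.+1) : xvertex := inl (inl k).
Definition hub2 (h : bool) : xvertex := inl (inr h).
Definition pend (i : 'I_m.+1) (h : bool) : xvertex := inr (i, h).

Definition xadj : rel xvertex := fun u w =>
  match u, w with
  | inl (inl _), inl (inr _) => true
  | inl (inr _), inl (inl _) => true
  | inl (inr h), inr (_, h') => h == h'
  | inr (_, h), inl (inr h') => h == h'
  | inr (i, h), inr (j, h') => (i == j) && (h != h')
  | _, _ => false
  end.

Lemma xadj_sym : symmetric xadj.
Proof.
move=> [[k|h]|[i h]] [[k'|h']|[i' h']] //=; rewrite 1?eq_sym //.
by congr (_ && _); rewrite eq_sym.
Qed.
Lemma xadj_irr : irreflexive xadj.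
Proof. by move=> [[k|h]|[i h]] //=; rewrite !eqxx. Qed.

Definition xgraph : sgraph := SGraph xadj_sym xadj_irr.

Local Ltac eval_edges := rewrite /edge_disjoint /same_edge /= ?xpair_eqE ?eqxx /= ?andbF //=.

Lemma xpaths (u w : xgraph) : u != w -> exists p q,
  [/\ path xadj u p, path xadj u q, edge_disjoint u p q,
      last u p = w /\ last u q = w & size p <= 3 /\ size q <= 4].
Proof.
have pendE i h i' h' : (inr (i, h) == inr (i', h') :> xvertex) =
  (i == i') && (h == h') by [].
pose i0 : 'I_m.+1 := ord0; pose k0 : 'I_t.+1 := ord0.
have finish (x y : xgraph) p q : path xadj x p && path xadj x q ->
  edge_disjoint x p q ->
    (last x p == y) && (last x q == y) -> (size p <= 3) && (size q <= 4) ->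
    exists p q, [/\ path xadj x p, path xadj x q, edge_disjoint x p q,
      last x p = y /\ last x q = y & size p <= 3 /\ size q <= 4].
  by move=> /andP[xp xq] pq /andP[/eqP lp /eqP lq] /andP[sp sq]; exists p, q.
case: u w => [[k|h]|[i h]] [[k'|h']|[i' h']] ne.
- by apply: (@finish _ _ [:: hub2 false; mid k'] [:: hub2 true; mid k']); eval_edges.
- apply: (@finish _ _ [:: hub2 h'] [:: hub2 (~~ h'); pend i0 (~~ h'); pend i0 h';
  hub2 h']);
  by case: h' {ne}; eval_edges.
- apply: (@finish _ _ [:: hub2 h'; pend i' h'] [:: hub2 (~~ h'); pend i' (~~ h');
  pend i' h']);
  by case: h' {ne}; eval_edges.
- apply: (@finish _ _ [:: mid k'] [:: pend i0 h; pend i0 (~~ h); hub2 (~~ h); mid k']);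
  by case: h {ne}; eval_edges.
- have -> : h' = ~~ h by case: h h' ne => [] [].
  apply: (@finish _ _ [:: mid k0; hub2 (~~ h)] [:: pend i0 h; pend i0 (~~ h);
    hub2 (~~ h)]);
  by case: h {ne}; eval_edges.
- case: (eqVneq h' h) {ne} => [->|/negPf hh].
    apply: (@finish _ _ [:: pend i' h] [:: mid k0; hub2 (~~ h); pend i' (~~ h);
      pend i' h]);
    by case: h; eval_edges.
  have -> : h' = ~~ h by case: h h' hh => [] [].
  apply: (@finish _ _ [:: pend i' h; pend i' (~~ h)] [:: mid k0; hub2 (~~ h);
    pend i' (~~ h)]);
  by case: h {hh}; eval_edges.
- apply: (@finish _ _ [:: hub2 h; mid k'] [:: pend i (~~ h); hub2 (~~ h); mid k']);
  by case: h {ne}; eval_edges.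
- case: (eqVneq h' h) {ne} => [->|/negPf hh].
    apply: (@finish _ _ [:: hub2 h] [:: pend i (~~ h); hub2 (~~ h); mid k0; hub2 h]);
    by case: h; eval_edges.
  have -> : h' = ~~ h by case: h h' hh => [] [].
  apply: (@finish _ _ [:: pend i (~~ h); hub2 (~~ h)] [:: hub2 h; mid k0; hub2 (~~ h)]);
  by case: h {hh}; eval_edges.
case: (eqVneq i i') => [ii|ii].
  rewrite -ii in ne *; have ii' := eqxx i; have -> : h' =
    ~~ h by case: h h' ne => [] []; rewrite ?eqxx.
  apply: (@finish _ _ [:: pend i (~~ h)] [:: hub2 h; mid k0; hub2 (~~ h);
    pend i (~~ h)]);
  by case: h {ne}; eval_edges.
have ii' := negPf ii; have i'i : (i' == i) = false by rewrite eq_sym.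
case: (eqVneq h' h) {ne} => [->|/negPf hh].
  apply: (@finish _ _ [:: hub2 h; pend i' h]
    [:: pend i (~~ h); hub2 (~~ h); pend i' (~~ h); pend i' h]);
  by case: h; eval_edges.
have -> : h' = ~~ h by case: h h' hh => [] [].
apply: (@finish _ _ [:: hub2 h; pend i' h; pend i' (~~ h)]
  [:: pend i (~~ h); hub2 (~~ h); pend i' (~~ h)]);
by case: h {hh}; eval_edges; rewrite /pend !pendE i'i.
Qed.

Definition xedge (c : 'I_m.+1 * option bool + 'I_t.+1 * bool) : {set xgraph} :=
  match c with
  | inl (i, Some h) => [set hub2 h; pend i h]
  | inl (i, None) => [set pend i false; pend i true]
  | inr (k, h) => [set mid k; hub2 h]
  end.

(** An upper bound suffices later, so [xedge] only has to cover the edges. *)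
Lemma card_xedges : #|edges xgraph| <= 3 * m.+1 + 2 * t.+1.
Proof.
have -> : 3 * m.+1 + 2 * t.+1 = #|{: 'I_m.+1 * option bool + 'I_t.+1 * bool}|.
  by rewrite card_sum !card_prod !card_ord card_option card_bool mulnC [2 * _]mulnC.
apply: leq_trans (leq_imset_card xedge _).
apply: subset_leq_card; apply/subsetP=> E /imsetP[[u w]]; rewrite inE /= => uw ->.
apply/imsetP; case: u w uw => [[k|h]|[i h]] [[k'|h']|[i' h']] //=.
- by exists (inr (k, h')).
- by exists (inr (k', h)); rewrite //= setUC.
- by move/eqP->; exists (inl (i', Some h')).
- by move/eqP->; exists (inl (i, Some h')); rewrite //= setUC.
- case/andP=> /eqP->; exists (inl (i', None)) => //=.
  by case: h h' b => [] [] // _; rewrite setUC.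
Qed.

Lemma card_xgraph : #|xgraph| = t + 2 * m + 5.
Proof. by rewrite card_sum card_sum card_prod !card_ord card_bool; lia. Qed.

Lemma xgraph_in_class lam : 4 <= lam -> in_class (t + 2 * m + 5) 3 lam 1 xgraph.
Proof.
move=> lam4; split=> [||S _ S1]; first exact: card_xgraph.
- apply/diam_leP=> u w; have [->|/xpaths] := eqVneq u w; first exact: within_refl.
  by case=> p [q [up _ _ [lp _] [sp _]]]; apply/within_path; exists p.
apply/diam_leP=> u w; have [->|/xpaths] := eqVneq u w; first exact: within_refl.
case=> p [q [up uq pq [lp lq] [sp sq]]]; apply/within_path.
case: (@two_paths xgraph S S1 u p q up uq pq) => h; [exists p|exists q]; split=> //.
  by apply: leq_trans sp _; apply: leq_trans lam4.
exact: leq_trans lam4.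
Qed.

End Extremal.

(** * Transfer to orientations and conclusion *)

Lemma within_cut (T : finType) (e : rel T) (S : pred T) k x y :
  within e k x y -> S x -> ~~ S y -> exists u w, [/\ S u, ~~ S w & e u w].
Proof.
elim: k x => [|k IH] x; first by rewrite /= orbF => /eqP-> ->.
case/orP=> [/eqP-> ->//|/existsP[z /andP[xz zy]]] xS yS.
by case: (boolP (S z)) => [zS|zS]; [apply: IH zy zS yS|exists x, z].
Qed.

(** Ordered adjacent pairs are grouped by their edge, with at most two pairs in each group. *)
Lemma sum_nbrs_edges (G : sgraph) :
  \sum_(z : G) #|nbrs (@adj G) z| <= 2 * #|edges G|.
Proof.
under eq_bigr => z _ do rewrite -sum1_card.
under eq_bigr => z _ do under eq_bigl => w do rewrite inE.
rewrite pair_big_dep /=.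
rewrite (partition_big (fun p : G * G => [set p.1; p.2]) [in edges G]) /=; last first.
  by move=> p hp; apply/imsetP; exists p; rewrite ?inE.
rewrite -sum1_card big_distrr /=; apply: leq_sum => E /imsetP[[x y]].
rewrite inE /= => xy ->.
rewrite sum1_card muln1; apply: leq_trans (_ : #|[set (x, y); (y, x)]| <= 2);
  last first.
  by rewrite cards2; case: eqP.
apply: subset_leq_card; apply/subsetP=> -[z w].
rewrite unfold_in /= => /andP[_ /eqP/set2_inj].
by rewrite !inE /same_edge /= !xpair_eqE /=.
Qed.

(** [R] may leave edges undirected, as the construction does between equal heights; these are
    directed by [enum_rank], and additional arcs only shorten distances. *)
Lemma oriented_diam_le (G : sgraph) (R : rel G) k :
  (forall u w, R u w -> adj u w) -> (forall u w, R u w -> ~~ R w u) ->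
  (forall u w, within R k u w) -> (oriented_diam G <= (k%:Z)%:E)%E.
Proof.
move=> Radj Rasym Rk.
pose D : {set G * G} := [set p | R p.1 p.2 ||
  [&& adj p.1 p.2, ~~ R p.2 p.1 & enum_rank p.1 < enum_rank p.2]].
apply: (@bigmin_inf _ _ _ _ D).
  apply/forallP=> u; apply/forallP=> w; rewrite /Defs.arc !inE /=.
  rewrite [adj w u]adj_sym; case: ifPn => uw; last first.
    by rewrite (negPf uw) orbF; apply: contra uw; apply: Radj.
  rewrite uw; case: (boolP (R u w)) => [/Rasym/negPf->|nuw] //=;
    case: (boolP (R w u)) => //= nwu.
  by case: ltngtP => // /val_inj/enum_rank_inj uwE; rewrite uwE adj_irr in uw.
apply/diam_leP=> u w; apply: within_sub (Rk u w) => x y xy.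
by rewrite /Defs.arc inE /= xy.
Qed.

Lemma ex_xgraph n : 5 <= n -> exists m t, n = t + 2 * m + 5 /\ t <= 1.
Proof.
by move=> n5; exists ((n - 5)./2), (odd (n - 5)); split; lia.
Qed.

Theorem theorem1 (n lam : nat) (hn : 5 <= n) (hlam : 4 <= lam)
    (G : sgraph) (hG : in_min_class n 3 lam 1 G) :
  (oriented_diam G <= (9%:Z)%:E)%E.
Proof.
case: hG => -[cardG /diam_leP diamG delG] minG.
have e_sym := @adj_sym G; have e_irr := @adj_irr G.
(* Deleting xy leaves a graph of finite diameter, in which a path from [x] to [y] must leave [S]. *)
have bridgeless (x y : G) (S : pred G) : adj x y -> S x -> ~~ S y ->
    exists u w, [/\ S u, ~~ S w, adj u w & (u, w) != (x, y)].
  move=> xy xS yS.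
  have sub : [set [set x; y]] \subset edges G.
    by rewrite sub1set; apply/imsetP; exists (x, y); rewrite ?inE.
  have := delG _ sub; rewrite cards1 => /(_ erefl)/diam_leP/(_ x y) h.
  have [u [w [uS wS /andP[uw uwE]]]] := within_cut h xS yS.
  by exists u, w; split=> //; apply: contraNneq uwE => -[-> ->]; rewrite inE.
have gt1 : 1 < #|G| by rewrite cardG; apply: leq_trans hn.
have [m [t [nE t1]]] := ex_xgraph hn.
(* By minimality 2e is at most 6m + 4t + 10, which is at most 3n - 4 because [t <= 1]. *)
have le_edges : 2 * #|edges G| + 4 <= 3 * n.
  have Hc := xgraph_in_class m t hlam; rewrite -nE in Hc.
  by have := leq_trans (minG _ Hc) (card_xedges m t); lia.
have [v [a [b [vE ab_nonadj]]]] : exists v a b : G,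
    nbrs (@adj G) v = [set a; b] /\ ~~ adj a b.
  case: (boolP [exists v : G, exists a : G, exists b : G,
      (nbrs (@adj G) v == [set a; b]) && ~~ adj a b]).
    case/existsP=> v /existsP[a /existsP[b /andP[/eqP vE ab]]].
    by exists v, a, b.
  move=> no; have tri (u x y : G) : nbrs (@adj G) u = [set x; y] -> adj x y.
    move=> uE; apply: contraNT no => xy.
    apply/existsP; exists u; apply/existsP; exists x; apply/existsP; exists y.
    by rewrite uE eqxx.
  (* Otherwise 3n <= 2e + 3, against [le_edges]. *)
  have := degree_sum_triangles e_sym e_irr diamG bridgeless gt1 tri.
  by have := sum_nbrs_edges G; rewrite cardG; lia.
have e_v u : adj v u = (u == a) || (u == b).
  have -> : adj v u = (u \in nbrs (@adj G) v) by rewrite inE.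
  by rewrite vE !inE.
have a_neq_b : a != b.
  have := nbrs_gt1 e_irr diamG bridgeless gt1 v; rewrite vE cards2.
  by case: eqP.
(* Bridgelessness is applied to the edge av: since [b] is outside [S], av is the only edge from [S]
   to [v], so the other crossing edge avoids [v]. *)
have no_bridge (S : pred G) : S a -> ~~ S b -> ~~ S v ->
    exists u w, [/\ S u, ~~ S w, w != v & adj u w].
  move=> aS bS vS; have av : adj a v by rewrite adj_sym e_v eqxx.
  have [u [w [uS wS uw ne]]] := bridgeless a v S av aS vS.
  exists u, w; split=> //; apply: contra ne => /eqP wv.
  move: uw; rewrite wv adj_sym e_v => /orP[/eqP->//|/eqP ub].
  by rewrite ub (negPf bS) in uS.
have [R [R1 R2 R3]] := ex_orientation e_sym e_irr e_v a_neq_b ab_nonadj diamG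
  (deg_gt1 e_irr bridgeless) no_bridge.
exact: oriented_diam_le R1 R2 R3.
Qed.
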